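(* Let $\underline{\pi}>0$ be such that the generator $f$ satisfies Assumption $\mathbf A_f(\underline\pi)$ and the reference policy $\pi_{\rm ref}$ satisfies Assumption $\mathbf P(\underline\pi)$. Assume moreover that $\rho_{\min}:=\min_{s\in\mathcal S}\rho(s)>0$. Then for every $\theta\in\mathbb R^{\mathcal S\times\mathcal A}$, $$\|\nabla_\theta v^f_\theta(\rho)\|_2^2\ \ge\ \mu_f(\theta)\,\bigl(v^f_\star(\rho)-v^f_\theta(\rho)\bigr),\qquad \mu_f(\theta):=\lambda(1-\gamma)\,\rho_{\min}^2\,\frac{\zeta_f^2}{\omega_f^2}\,\min_{(s,a)\in\mathcal S\times\mathcal A}\mathrm w^f_\theta(a|s)^2 .$$
   Context: Setting. $\mathcal S,\mathcal A$ are finite nonempty sets; $\mathcal P(X)$ is the set of probability distributions on a finite set $X$; $\gamma\in(0,1)$; $P(\cdot|s,a)\in\mathcal P(\mathcal S)$ is a transition kernel; $r:\mathcal S\times\mathcal A\to[0,1]$ is a reward; $\rho\in\mathcal P(\mathcal S)$ is an initial distribution; $\lambda>0$ is a temperature. A policy is a map $\pi:\mathcal S\to\mathcal P(\mathcal A)$; $\pi_{\rm ref}$ is a fixed reference policy. $f$ is a strictly convex generator with $f(1)=0$, and for $p,q\in\mathcal P(\mathcal A)$ with $q$ of full support $D^f(p\|q)=\sum_a q(a)f(p(a)/q(a))$ (with $f(0)=\lim_{u\downarrow0}f(u)$). The regularized value is $v^f_\pi(s)=\mathbb E^\pi_s[\sum_{t\ge0}\gamma^t(r(S_t,A_t)-\lambda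 D^f(\pi(\cdot|S_t)\|\pi_{\rm ref}(\cdot|S_t)))]$ (with $S_0=s$, $A_t\sim\pi(\cdot|S_t)$, $S_{t+1}\sim P(\cdot|S_t,A_t)$), $v^f_\pi(\rho)=\sum_s\rho(s)v^f_\pi(s)$, and $v^f_\star(s)=\max_\pi v^f_\pi(s)$, $v^f_\star(\rho)=\sum_s\rho(s)v^f_\star(s)$. For $\theta\in\mathbb R^{\mathcal S\times\mathcal A}$ the $f$-softargmax policy is $\pi^f_\theta(\cdot|s)=\arg\max_{\nu\in\mathcal P(\mathcal A)}\{\langle\nu,\theta(s,\cdot)\rangle-D^f(\nu\|\pi_{\rm ref}(\cdot|s))\}$, and $v^f_\theta:=v^f_{\pi^f_\theta}$. Assumption $\mathbf P(\underline\pi)$: $\pi_{\rm ref}(a|s)>\underline\pi$ for all $(s,a)$. Assumption $\mathbf A_f(\underline\pi)$: (i) $f$ is bounded and strictly convex on $[0,1/\underline\pi]$, $f(1)=0$, and $f$ is thrice differentiable on $(0,1/\underline\pi)$; (ii) $\lim_{u\downarrow0}f'(u)=-\infty$ and $\lim_{u\to0}|f'(u)/f''(u)|<\infty$; (iii) there are constants $\omega_f\in[1,\infty)$, $\kappa_f\in(0,\infty)$ with $1/(uf''(u))\le\omega_f$ and $|f'''(u)/f''(u)^2|\le\kappa_f$ for all $u\in[0,1/\underline\pi]$ where these expressions are defined; (iv) there is $\iota_f\in(0,1]$ such that $f''$ is decreasing on $(0,\iota_f]$ and $f''(\iota_f)\ge f''(u)$ for $u\in[\iota_f,1/\underline\pi]$.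 Weights: $\mathrm W^f_\theta(s)=\sum_a\pi_{\rm ref}(a|s)/f''(\pi^f_\theta(a|s)/\pi_{\rm ref}(a|s))$ and $\mathrm w^f_\theta(a|s)=\frac{1}{\mathrm W^f_\theta(s)}\,\pi_{\rm ref}(a|s)/f''(\pi^f_\theta(a|s)/\pi_{\rm ref}(a|s))$. Constant (values at $\nu(a)=0$ are understood as limits $u\downarrow0$): $\zeta_f=\min_{s\in\mathcal S,\nu\in\mathcal P(\mathcal A)}\sum_a\pi_{\rm ref}(a|s)/f''(\nu(a)/\pi_{\rm ref}(a|s))>0$. *)

(* Defs.v *)
From HB Require Import structures.
From mathcomp Require Import all_boot all_order all_algebra.
From mathcomp Require Import all_classical all_reals all_analysis.

Set Implicit Arguments.
Unset Strict Implicit.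
Unset Printing Implicit Defensive.

Import Order.TTheory GRing.Theory Num.Theory.
Import numFieldNormedType.Exports.

Local Open Scope ring_scope.
Local Open Scope classical_set_scope.

Definition is_distr (R : realType) (X : finType) (p : X -> R) : Prop :=
  (forall x, 0 <= p x) /\ \sum_x p x = 1.

Definition is_policy (R : realType) (S A : finType) (pi : S -> A -> R) : Prop :=
  forall s, is_distr (pi s).

Record regularized_mdp (R : realType) (S A : finType) := RegularizedMDP {
  trans : S -> A -> S -> R;
  reward : S -> A -> R;
  discount : R;
  init : S -> R;
  temp : R;
  ref : S -> A -> R;
  trans_distr : forall s a, is_distr (trans s a);
  reward_bounds : forall s a, 0 <= reward s a <= 1;
  discount_bounds : 0 < discount < 1;
  init_distr : is_distr init;
  temp_gt0 : 0 < temp;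
  ref_policy : is_policy ref
}.

(* A realization of the controlled process on a measurable space [Omega]:
   [traj_law pi s] is the probability under which S_0 = s and, conditionally
   on the past, A_t ~ pi(.|S_t) and S_{t+1} ~ P(.|S_t, A_t).  The conditional
   laws are written in multiplied-out form, so that no division by the
   probability of a null history occurs.  The type of [h] is that of infinite
   sequences, but only its first terms matter. *)
Record trajectories (R : realType) (S A : finType) (M : regularized_mdp R S A)
    (d : measure_display) (Omega : measurableType d) := Trajectories {
  St : nat -> Omega -> S;
  At : nat -> Omega -> A;
  traj_law : (S -> A -> R) -> S -> probability Omega R;
  hist := fun (t : nat) (h : nat -> S * A) =>
    [set w | forall k, (k < t)%N -> St k w = (h k).1 /\ At k w = (h k).2];
  measurable_St : forall t s, measurable [set w | St t w = s];
  measurable_At : forall t a, measurable [set w | At t w = a];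
  law_start : forall pi s, is_policy pi ->
    traj_law pi s [set w | St 0%N w = s] = 1%E;
  law_action : forall pi s, is_policy pi -> forall t h s' a',
    traj_law pi s (hist t h `&` [set w | St t w = s' /\ At t w = a']) =
    (traj_law pi s (hist t h `&` [set w | St t w = s']) * (pi s' a')%:E)%E;
  law_state : forall pi s, is_policy pi -> forall t h s',
    traj_law pi s (hist t.+1 h `&` [set w | St t.+1 w = s']) =
    (traj_law pi s (hist t.+1 h) * (trans M (h t).1 (h t).2 s')%:E)%E
}.

(* Only the values of [f] on [0, 1/pmin] matter.  The third field is the
   convention f(0) = lim_{u -> 0+} f(u).  Derivatives of [f] are only used on
   the open interval ]0, 1/pmin[, where they are assumed to exist. *)
Record generator_assumption (R : realType) (f : R -> R)
    (pmin omega kappa iota : R) : Prop := GeneratorAssumption {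
  gen_bounded : exists C : R, forall u : R, 0 <= u <= pmin^-1 -> `|f u| <= C;
  gen_strictly_convex : forall x y t : R,
    0 <= x <= pmin^-1 -> 0 <= y <= pmin^-1 -> x != y -> 0 < t < 1 ->
    f (t * x + (1 - t) * y) < t * f x + (1 - t) * f y;
  gen_right_limit0 : f u @[u --> 0^'+] --> f 0;
  gen_at1 : f 1 = 0;
  gen_derivable3 : forall (k : nat) (u : R), (k < 3)%N -> 0 < u < pmin^-1 ->
    derivable (derive1n k f) u 1;
  gen_deriv0 : derive1 f u @[u --> 0^'+] --> -oo;
  gen_ratio0 : cvg (`|derive1 f u / derive1n 2 f u| @[u --> 0^'+]);
  gen_omega_ge1 : 1 <= omega;
  gen_kappa_gt0 : 0 < kappa;
  gen_omega : forall u : R, 0 < u < pmin^-1 -> derive1n 2 f u != 0 ->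
    1 / (u * derive1n 2 f u) <= omega;
  gen_kappa : forall u : R, 0 < u < pmin^-1 -> derive1n 2 f u != 0 ->
    `|derive1n 3 f u / derive1n 2 f u ^+ 2| <= kappa;
  gen_iota : 0 < iota <= 1;
  gen_decreasing : forall u v : R, 0 < u -> u <= v -> v <= iota ->
    derive1n 2 f v <= derive1n 2 f u;
  gen_iota_max : forall u : R, iota <= u < pmin^-1 -> derive1n 2 f u <= derive1n 2 f iota
}.

Definition fdiv (R : realType) (A : finType) (f : R -> R) (p q : A -> R) : R :=
  \sum_a q a * f (p a / q a).

Definition softargmax (R : realType) (S A : finType) (f : R -> R)
    (pi_ref : S -> A -> R) (theta : S -> A -> R) (s : S) : A -> R :=
  let obj (nu : A -> R) := \sum_a nu a * theta s a - fdiv f nu (pi_ref s) in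
  get [set nu | is_distr nu /\ forall nu', is_distr nu' -> obj nu' <= obj nu].

Definition discounted_return (R : realType) (S A : finType) (M : regularized_mdp R S A)
    (d : measure_display) (Omega : measurableType d)
    (X : trajectories M Omega) (f : R -> R) (pi : S -> A -> R) (w : Omega) : R :=
  \big[+%R/0]_(0 <= t <oo) (discount M ^+ t *
    (reward M (St X t w) (At X t w)
     - temp M * fdiv f (pi (St X t w)) (ref M (St X t w)))).

Definition value (R : realType) (S A : finType) (M : regularized_mdp R S A)
    (d : measure_display) (Omega : measurableType d)
    (X : trajectories M Omega) (f : R -> R) (pi : S -> A -> R) (s : S) : R :=
  fine ('E_(traj_law X pi s)[discounted_return X f pi])%E.

Definition value_init (R : realType) (S A : finType) (M : regularized_mdp R S A)
    (d : measure_display) (Omega : measurableType d)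
    (X : trajectories M Omega) (f : R -> R) (pi : S -> A -> R) : R :=
  \sum_s init M s * value X f pi s.

(* Here and below, the maxima and minima of nonempty bounded sets of reals are
   rendered with [sup] and [inf]. *)
Definition opt_value (R : realType) (S A : finType) (M : regularized_mdp R S A)
    (d : measure_display) (Omega : measurableType d)
    (X : trajectories M Omega) (f : R -> R) (s : S) : R :=
  sup [set value X f pi s | pi in [set pi | is_policy pi]].

Definition opt_value_init (R : realType) (S A : finType)
    (M : regularized_mdp R S A) (d : measure_display)
    (Omega : measurableType d) (X : trajectories M Omega) (f : R -> R) : R :=
  \sum_s init M s * opt_value X f s.

Definition value_param (R : realType) (S A : finType)
    (M : regularized_mdp R S A) (d : measure_display)
    (Omega : measurableType d) (X : trajectories M Omega) (f : R -> R)
    (theta : S -> A -> R) : R :=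
  value_init X f (softargmax f (ref M) theta).

Definition update (R : realType) (S A : finType) (theta : S -> A -> R)
    (s : S) (a : A) (x : R) : S -> A -> R :=
  fun s' a' => if (s' == s) && (a' == a) then x else theta s' a'.

Definition gradient (R : realType) (S A : finType)
    (F : (S -> A -> R) -> R) (theta : S -> A -> R) : S -> A -> R :=
  fun s a => derive1 (fun x : R => F (update theta s a x)) (theta s a).

Definition sqnorm2 (R : realType) (S A : finType) (g : S -> A -> R) : R :=
  \sum_s \sum_a g s a ^+ 2.

Definition weight_sum (R : realType) (S A : finType) (f : R -> R)
    (pi_ref theta : S -> A -> R) (s : S) : R :=
  \sum_a pi_ref s a / derive1n 2 f (softargmax f pi_ref theta s a / pi_ref s a).

Definition weight (R : realType) (S A : finType) (f : R -> R)
    (pi_ref theta : S -> A -> R) (s : S) (a : A) : R :=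
  1 / weight_sum f pi_ref theta s *
  (pi_ref s a / derive1n 2 f (softargmax f pi_ref theta s a / pi_ref s a)).

(* 1 / f'', extended to 0 by its right limit. *)
Definition inv_deriv2 (R : realType) (f : R -> R) (u : R) : R :=
  if u == 0 then lim ((derive1n 2 f x)^-1 @[x --> 0^'+]) else (derive1n 2 f u)^-1.

Definition zeta (R : realType) (S A : finType) (f : R -> R)
    (pi_ref : S -> A -> R) : R :=
  inf [set \sum_a pi_ref s a * inv_deriv2 f (nu a / pi_ref s a)
      | s in [set: S] & nu in [set nu | is_distr nu]].

Definition init_min (R : realType) (S A : finType)
    (M : regularized_mdp R S A) : R := inf (range (init M)).

Definition mu (R : realType) (S A : finType) (M : regularized_mdp R S A)
    (f : R -> R) (omega : R) (theta : S -> A -> R) : R :=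
  temp M * (1 - discount M) * init_min M ^+ 2 *
  (zeta f (ref M) ^+ 2 / omega ^+ 2) *
  inf [set weight f (ref M) theta sa.1 sa.2 ^+ 2 | sa in [set: S * A]].

(* Main.v *)
Require Import Defs.
From HB Require Import structures.
From mathcomp Require Import all_boot all_order all_algebra.
From mathcomp Require Import all_classical all_reals all_analysis.
From mathcomp Require Import measurable_realfun.
From mathcomp Require Import ring lra.
Import Order.TTheory GRing.Theory Num.Theory.
Import numFieldNormedType.Exports.
Local Open Scope ring_scope.
Local Open Scope classical_set_scope.

Set Implicit Arguments.
Unset Strict Implicit.
Unset Printing Implicit Defensive.

(** Write [r s a] for [pi_ref / f''(pi_theta / pi_ref)], [q] for the action
    values of [pi_theta], [xi = q - lambda theta], and [xibar s] for the mean of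
    [xi s] with weights [w s].  Stationarity, f'(pi_theta / pi_ref) = theta - c,
    gives the gradient
      [n s * r s a * (xi s a - xibar s)]
    where [n s >= rho s] is the discounted occupancy of [s], and
    [r s a = W s * w s a >= zeta * w s a].  On the other hand the
    divergence is [1/omega]-strongly convex because [f''(u) >= 1 / (omega u)],
    so that, again by stationarity, improving [pi_theta] at [s] for one step
    gains at most [omega / (2 lambda) * \sum_a (xi s a - xibar s) ^+ 2].
    By the contraction property of the evaluation operator, the suboptimality of
    [pi_theta] is at most [1 / (1 - gamma)] times the largest of these gains. *)

(** * Generators *)

(* [f1] and [f2] stand for f' and f''; keeping them abstract prevents
   conversion from unfolding iterated derivatives. *)
Record steep_generator (R : realType) (f f1 f2 : R -> R) (pmin omega : R) : Prop :=
  SteepGenerator {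
  steep_is_derive1 : forall u : R, 0 < u < pmin^-1 -> is_derive u 1 f (f1 u);
  steep_is_derive2 : forall u : R, 0 < u < pmin^-1 -> is_derive u 1 f1 (f2 u);
  steep_continuous2 : forall u : R, 0 < u < pmin^-1 -> {for u, continuous f2};
  steep_right_limit0 : f u @[u --> 0^'+] --> f 0;
  steep_deriv0 : f1 u @[u --> 0^'+] --> -oo;
  steep_omega_gt0 : 0 < omega;
  steep_omega : forall u : R, 0 < u < pmin^-1 -> f2 u != 0 ->
    1 / (u * f2 u) <= omega
}.

Lemma generator_steep (R : realType) (f : R -> R) (pmin omega kappa iota : R) :
  generator_assumption f pmin omega kappa iota ->
  steep_generator f (derive1 f) (derive1n 2 f) pmin omega.
Proof.
move=> gen; split.
- move=> u /(gen_derivable3 gen (isT : (0 < 3)%N)).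
  by rewrite derive1E => /derivableP.
- move=> u /(gen_derivable3 gen (isT : (1 < 3)%N)).
  by rewrite /= derive1E => /derivableP.
- move=> u /(gen_derivable3 gen (isT : (2 < 3)%N)).
  by move=> /derivable1_diffP /differentiable_continuous.
- exact: (gen_right_limit0 gen).
- exact: (gen_deriv0 gen).
- exact: lt_le_trans ltr01 (gen_omega_ge1 gen).
- exact: (gen_omega gen).
Qed.

Section generator.
Context (R : realType) (f f1 f2 : R -> R) (pmin omega : R).
Hypotheses (pmin_gt0 : 0 < pmin) (gen : steep_generator f f1 f2 pmin omega).

Let omega_gt0 : 0 < omega := steep_omega_gt0 gen.

Lemma gen_deriv1_continuous (u : R) : 0 < u < pmin^-1 -> {for u, continuous f1}.
Proof.
move=> /(steep_is_derive2 gen) [/derivable1_diffP df _].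
exact: differentiable_continuous.
Qed.

Lemma gen_continuous (u : R) : 0 < u < pmin^-1 -> {for u, continuous f}.
Proof.
move=> /(steep_is_derive1 gen) [/derivable1_diffP df _].
exact: differentiable_continuous.
Qed.

Lemma within_gen_deriv1_continuous (a b : R) :
  0 < a -> b < pmin^-1 -> {within `[a, b], continuous f1}.
Proof.
move=> a0 b1; apply: continuous_in_subspaceT => u.
rewrite inE /= in_itv /= => /andP[au ub]; apply: gen_deriv1_continuous.
by rewrite (lt_le_trans a0 au) (le_lt_trans ub b1).
Qed.

(** Continuity at 0 is only one-sided and comes from the convention [f 0 = lim f]. Reaching 0
    matters because a competing distribution may vanish at some action, where [f1] diverges. *)
Lemma within_gen_continuous (b : R) : b < pmin^-1 -> {within `[0, b], continuous f}.
Proof.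
move=> b1; have [b0|b0] := ltP 0 b; last first.
  have [->|bn0] := eqVneq b 0.
    by rewrite set_itv1; exact: continuous_subspace1.
  rewrite set_itv_ge ?bnd_simp; first exact: continuous_subspace0.
  by rewrite -ltNge lt_neqAle bn0.
apply/continuous_within_itvP => //; split.
- move=> u; rewrite in_itv /= => /andP[u0 ub].
  by apply: gen_continuous; rewrite u0 (lt_trans ub b1).
- exact: (steep_right_limit0 gen).
- apply: cvg_at_left_filter; apply: gen_continuous; by rewrite b0.
Qed.

Lemma gen_deriv1_unbounded (y b : R) : 0 < b -> exists x, 0 < x < b /\ f1 x < y.
Proof.
move=> b0; have := steep_deriv0 gen => /cvgrNyPltr /(_ y (num_real y)) H.
have : \forall x \near 0^'+, 0 < x < b /\ f1 x < y.
  near=> x; split; last by near: x.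
  by apply/andP; split; near: x; [exact: nbhs_right_gt|exact: nbhs_right_lt].
by move=> /(@filter_ex _ _ _).
Unshelve. all: by end_near.
Qed.

(* The bound [1 / (u f'') <= omega] leaves a gap between 0 and the positive
   values of [f''], which the continuous function [f''] cannot cross. *)
Lemma gen_deriv2_gt0 (u : R) : 0 < u < pmin^-1 -> 0 < f2 u.
Proof.
move=> /andP[u0 u1]; rewrite ltNge; apply/negP => fu.
(* If [f2 u <= 0], a point [x < u] with [f1 x < f1 u] still exists, so the mean value theorem gives
   [z] in between with [f2 z > 0]. *)
have [x [/andP[x0 xu] fx]] := gen_deriv1_unbounded (f1 u) u0.
have [||z zxu fzE] := @MVT _ f1 f2 x u xu.
- move=> z; rewrite in_itv /= => /andP[xz zu]; apply: (steep_is_derive2 gen).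
  by rewrite (lt_trans x0 xz) (lt_trans zu u1).
- exact: within_gen_deriv1_continuous.
move: zxu; rewrite in_itv /= => /andP[xz zu].
have z0 := lt_trans x0 xz; have z1 := lt_trans zu u1.
have fz0 : 0 < f2 z.
  by move: fx; rewrite -subr_gt0 fzE pmulr_lgt0 // subr_gt0.
(* A positive value of [f2] at [t < 1 / pmin] is at least [1 / (omega * t)], hence at least [c]. The
   level [c / 2] used below therefore lies inside the forbidden gap. *)
pose c := pmin / omega.
have c0 : 0 < c by rewrite divr_gt0.
have gap t : 0 < t < pmin^-1 -> 0 < f2 t -> c <= f2 t.
  move=> t_in ft0; have /andP[t0 t1] := t_in.
  have := steep_omega gen t_in (lt0r_neq0 ft0).
  move: (f2 t) ft0 => y y0; rewrite ler_pdivrMr ?mulr_gt0 // => h.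
  rewrite /c ler_pdivrMr //.
  have tp : t * pmin <= 1.
    by rewrite -(mulVf (lt0r_neq0 pmin_gt0)) ler_pM2r // ltW.
  rewrite -(ler_pM2l t0) (le_trans tp) // (le_trans h) //.
  by rewrite [leRHS]mulrA [leRHS]mulrC.
have [||v] := @IVT _ f2 z u (c / 2) (ltW zu).
- apply: continuous_in_subspaceT => t.
  rewrite inE /= in_itv /= => /andP[zt tu]; apply: (steep_continuous2 gen).
  by rewrite (lt_le_trans z0 zt) (le_lt_trans tu u1).
- rewrite ge_min le_max; apply/andP; split.
    by rewrite (le_trans fu) ?orbT // divr_ge0 // ltW.
  have := gap z; rewrite z0 z1 fz0 => /(_ isT isT) h.
  by rewrite (le_trans _ h) // ler_pdivrMr // ler_peMr ?ler1n // ltW.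
rewrite in_itv /= => /andP[zv vu] fv.
have := gap v; rewrite (lt_le_trans z0 zv) (le_lt_trans vu u1) fv divr_gt0 //.
move=> /(_ isT isT); lra.
Qed.

Lemma gen_deriv2_ge (u : R) : 0 < u < pmin^-1 -> 1 / (omega * u) <= f2 u.
Proof.
move=> u_in; have /andP[u0 u1] := u_in; have f0 := gen_deriv2_gt0 u_in.
have := steep_omega gen u_in (lt0r_neq0 f0).
move: (f2 u) f0 => y y0; rewrite !ler_pdivrMr ?mulr_gt0 // => h; apply: le_trans h _.
by rewrite mulrA [X in _ <= X]mulrC.
Qed.

(** Squeezed between 0 and [omega * u]. This shows that the limit in [inv_deriv2] at 0 is a genuine
    one, with value 0. *)
Lemma inv_gen_deriv2_cvg0 : (f2 u)^-1 @[u --> 0^'+] --> 0.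
Proof.
apply: (@squeeze_cvgr _ _ _ _ (fun=> 0) (fun u : R => omega * u)).
- have p0 : 0 < pmin^-1 by rewrite invr_gt0.
  near=> u; have u_in : 0 < u < pmin^-1.
    by apply/andP; split; near: u; [exact: nbhs_right_gt|exact: nbhs_right_lt].
  have /andP[u0 _] := u_in; have f0 := gen_deriv2_gt0 u_in.
  rewrite invr_ge0 ltW //= -[leRHS]invrK lef_pV2 ?posrE ?invr_gt0 ?mulr_gt0 //.
  by rewrite -[leLHS]div1r gen_deriv2_ge.
- exact: cvg_cst.
- apply: cvg_at_right_filter; rewrite -[X in _ --> X](mulr0 omega).
  by apply: cvgM; [exact: cvg_cst|exact: cvg_id].
Unshelve. all: by end_near.
Qed.

(** By the mean value theorem the slope is some [f2 z] with [z < b], so it is at least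
    [1 / (omega * b)]. The free [m] serves three uses: strict monotonicity, strong convexity, and
    the Lipschitz bound for the inverse of [f1]. *)
Lemma gen_deriv1_incr (m a b : R) : 0 < a -> a < b -> b < pmin^-1 ->
  m * omega * b <= 1 -> m * (b - a) <= f1 b - f1 a.
Proof.
move=> a0 ab b1 mb.
have [||z zab ->] := @MVT _ f1 f2 a b ab.
- move=> z; rewrite in_itv /= => /andP[az zb]; apply: (steep_is_derive2 gen).
  by rewrite (lt_trans a0 az) (lt_trans zb b1).
- exact: within_gen_deriv1_continuous.
move: zab; rewrite in_itv /= => /andP[az zb]; have z0 := lt_trans a0 az.
have z_in : 0 < z < pmin^-1 by rewrite z0 (lt_trans zb b1).
rewrite ler_pM2r ?subr_gt0 //; apply: le_trans (gen_deriv2_ge z_in).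
rewrite ler_pdivlMr ?mulr_gt0 // mulrA.
have [m0|m0] := leP m 0; last first.
  by apply: le_trans mb; rewrite ler_pM2l ?mulr_gt0 // ltW.
by apply: le_trans ler01; rewrite -mulrA mulr_le0_ge0 // mulr_ge0 // ltW.
Qed.

Lemma gen_deriv1_lt (a b : R) : 0 < a -> a < b -> b < pmin^-1 -> f1 a < f1 b.
Proof.
move=> a0 ab b1; have b0 := lt_trans a0 ab.
have ob0 : 0 < omega * b by rewrite mulr_gt0.
rewrite -subr_gt0; apply: lt_le_trans (@gen_deriv1_incr (omega * b)^-1 _ _ a0 ab b1 _).
  by rewrite mulr_gt0 ?invr_gt0 ?subr_gt0.
by rewrite -mulrA mulVf ?gt_eqF.
Qed.

(** On ratios up to [q^-1] the second derivative is at least [q / omega]. After multiplication by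
    [q] and the substitution [u = nu / q], the quadratic coefficient becomes [1 / (2 * omega)], the
    same for every action. *)
Lemma gen_strongly_convex (q x y : R) : pmin < q -> 0 <= x <= q^-1 -> 0 < y <= q^-1 ->
  f y + f1 y * (x - y) + q / (2 * omega) * (x - y) ^+ 2 <= f x.
Proof.
move=> pq /andP[x0 xq] /andP[y0 yq].
have q0 : 0 < q by exact: lt_trans pq.
have qp : q^-1 < pmin^-1 by rewrite ltf_pV2 ?posrE.
pose m : R := q / omega.
(* [psi] is [f] minus the variable part of the quadratic minorant at [y]. Its derivative [dpsi] is
   nonpositive before [y] and nonnegative after it, so [psi] is minimal at [y]. *)
pose psi z := f z - (f1 y * (z - y) + m / 2 * (z - y) ^+ 2).
pose dpsi z := f1 z - (f1 y + m * (z - y)).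
have in_pmin (z : R) : 0 < z -> z <= q^-1 -> 0 < z < pmin^-1.
  by move=> -> zq; rewrite (le_lt_trans zq qp).
have psi_derive (z : R) : 0 < z -> z <= q^-1 -> is_derive z 1 psi (dpsi z).
  move=> z0 zq; have fz := steep_is_derive1 gen (in_pmin _ z0 zq).
  by apply: is_derive_eq; rewrite /dpsi /GRing.scale /=; field.
have psi_cont (b : R) : b <= q^-1 -> {within `[0, b], continuous psi}.
  move=> bq; have fc := @within_gen_continuous b (le_lt_trans bq qp).
  have qc : continuous (fun z : R => f1 y * (z - y) + m / 2 * (z - y) ^+ 2).
    move=> t; have tc : z - y @[z --> t] --> t - y.
      by apply: cvgB; [exact: cvg_id|exact: cvg_cst].
    by apply: cvgD; apply: cvgM; [exact: cvg_cst| |exact: cvg_cst|apply: cvgM].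
  move=> t; apply: cvgB; first exact: fc.
  exact: (@continuous_subspaceT _ _ `[0, b] _ qc t).
have f'_incr (a b : R) : 0 < a -> a < b -> b <= q^-1 -> m * (b - a) <= f1 b - f1 a.
  move=> a0 ab bq.
  apply: gen_deriv1_incr => //; first exact: le_lt_trans qp.
  by rewrite /m divfK ?gt_eqF // -(mulfV (lt0r_neq0 q0)) ler_pM2l.
suff : psi y <= psi x.
  rewrite /psi subrr expr0n /= !mulr0 addr0 subr0 /m => h.
  rewrite -addrA -lerBrDr; apply: le_trans h _; rewrite lerD2l lerN2 lerD2l.
  by rewrite (_ : q / (2 * omega) = q / omega / 2) // invfM mulrA mulrAC.
have [xy|yx|->//] := ltgtP x y.
- have [||z] := @MVT _ psi dpsi x y xy.
  + move=> z; rewrite in_itv /= => /andP[xz zy].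
    by apply: psi_derive; [exact: le_lt_trans xz|exact: le_trans (ltW zy) yq].
  + apply: continuous_subspaceW (psi_cont y yq) => z /=.
    by rewrite !in_itv /= => /andP[xz ->]; rewrite (le_trans x0).
  rewrite in_itv /= => /andP[xz zy] psiE; rewrite -subr_le0 psiE.
  apply: mulr_le0_ge0; last by rewrite subr_ge0 ltW.
  have := f'_incr z y (le_lt_trans x0 xz) zy yq; rewrite /dpsi; lra.
- have [||z] := @MVT _ psi dpsi y x yx.
  + move=> z; rewrite in_itv /= => /andP[yz zx].
    by apply: psi_derive; [exact: lt_trans yz|exact: le_trans (ltW zx) xq].
  + apply: continuous_subspaceW (psi_cont x xq) => z /=.
    by rewrite !in_itv /= => /andP[yz ->]; rewrite (le_trans (ltW y0)).
  rewrite in_itv /= => /andP[yz zx] psiE; rewrite -subr_ge0 psiE.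
  apply: mulr_ge0; last by rewrite subr_ge0 ltW.
  have := f'_incr y z y0 yz (le_trans (ltW zx) xq); rewrite /dpsi; lra.
Qed.














































End generator.

Lemma inv_deriv2_ge0 (R : realType) (f : R -> R) (pmin omega u : R) : 0 < pmin ->
  steep_generator f (derive1 f) (derive1n 2 f) pmin omega ->
  0 <= u < pmin^-1 -> 0 <= inv_deriv2 f u.
Proof.
move=> p0 gen /andP[u0 u1]; rewrite /inv_deriv2; case: eqVneq => [_|un0].
  by rewrite (cvg_lim _ (inv_gen_deriv2_cvg0 p0 gen)).
by rewrite invr_ge0 ltW // (gen_deriv2_gt0 p0 gen) // lt_neqAle eq_sym un0 u0.
Qed.

(** * The softargmax at one state *)

Lemma distr_le1 (R : realType) (X : finType) (p : X -> R) x :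
  is_distr p -> p x <= 1.
Proof.
move=> [p0 <-]; rewrite (bigD1 x) //= lerDl.
by apply: sumr_ge0 => y _; exact: p0.
Qed.

Lemma distr_const (R : realType) (X : finType) (p : X -> R) (c : R) :
  is_distr p -> \sum_x p x * c = c.
Proof. by move=> [_ p1]; rewrite -mulr_suml p1 mul1r. Qed.

Section softargmax.
Context (R : realType) (A : finType) (f f1 f2 : R -> R) (pmin omega : R).
Hypotheses (pmin_gt0 : 0 < pmin)
  (gen : steep_generator f f1 f2 pmin omega).
Context (q : A -> R).
Hypotheses (q_distr : is_distr q) (q_gt : forall a, pmin < q a).

Let omega_gt0 : 0 < omega := steep_omega_gt0 gen.

Let q_gt0 a : 0 < q a. Proof. exact: lt_trans (q_gt a). Qed.

Let q_neq0 a : q a != 0. Proof. exact: lt0r_neq0. Qed.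

Definition regularized_obj (th nu : A -> R) : R :=
  \sum_a nu a * th a - fdiv f nu q.

(** Written so that [softargmax] at a state is convertible to it. *)
Definition state_softargmax (th : A -> R) : A -> R :=
  get [set nu | is_distr nu /\ forall nu', is_distr nu' ->
    regularized_obj th nu' <= regularized_obj th nu].

(** The first-order optimality condition on the simplex: [c] is the Lagrange multiplier of the total
    mass, and positivity excludes boundary points. *)
Definition stationary (th : A -> R) (c : R) (nu : A -> R) : Prop :=
  [/\ is_distr nu, forall a, 0 < nu a & forall a, f1 (nu a / q a) = th a - c].

Lemma distr_ratio (nu : A -> R) a : is_distr nu -> 0 <= nu a / q a <= (q a)^-1.
Proof.
move=> nuP; apply/andP; split; first by rewrite divr_ge0 ?nuP.1 // ltW.
by rewrite ler_pdivrMr // mulVf // distr_le1.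
Qed.

Lemma distr_ratio_lt (nu : A -> R) a : is_distr nu -> 0 <= nu a / q a < pmin^-1.
Proof.
move=> nuP; have /andP[-> h] := distr_ratio a nuP.
by rewrite (le_lt_trans h) // ltf_pV2 ?posrE.
Qed.

(* Strong convexity of the divergence at a stationary point, with respect to a
   possibly different linear term [th']. *)
Lemma stationary_gap (th th' : A -> R) (c : R) (nu nu' : A -> R) :
  stationary th c nu -> is_distr nu' ->
  regularized_obj th' nu' - regularized_obj th' nu <=
  \sum_a (nu' a - nu a) * (th' a - th a)
  - (2 * omega)^-1 * \sum_a (nu' a - nu a) ^+ 2.
Proof.
move=> [nuP nu0 nuE] nu'P.
(* The multiplier disappears because both distributions have the same mass. *)
have diff0 : \sum_a (nu' a - nu a) * c = 0.
  by rewrite -mulr_suml sumrB nuP.2 nu'P.2 subrr mul0r.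
rewrite /regularized_obj /fdiv -[leRHS]addr0 -[X in _ <= _ + X]diff0 mulr_sumr.
rewrite -!sumrB -big_split /=.
apply: ler_sum => a _.
have := @gen_strongly_convex _ _ _ _ _ _ pmin_gt0 gen (q a) (nu' a / q a) (nu a / q a)
  (q_gt a) (distr_ratio a nu'P).
rewrite divr_gt0 ?nu0 // (andP (distr_ratio a nuP)).2 => /(_ isT).
rewrite nuE => /(ler_wpM2l (ltW (q_gt0 a))).
have -> : q a * (f (nu a / q a) + (th a - c) * (nu' a / q a - nu a / q a) +
    q a / (2 * omega) * (nu' a / q a - nu a / q a) ^+ 2) =
  q a * f (nu a / q a) + (th a - c) * (nu' a - nu a) +
    (2 * omega)^-1 * (nu' a - nu a) ^+ 2.
  by field; rewrite q_neq0 gt_eqF.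
lra.
Qed.

(** With equal linear terms, [stationary_gap] keeps only the quadratic margin: [nu] beats every
    other distribution strictly, so the choice made by [get] is forced. *)
Lemma stationary_softargmax (th : A -> R) (c : R) (nu : A -> R) :
  stationary th c nu -> state_softargmax th = nu.
Proof.
move=> nuS; have [nuP _ _] := nuS.
have gap nu' : is_distr nu' -> regularized_obj th nu' - regularized_obj th nu <=
    - ((2 * omega)^-1 * \sum_a (nu' a - nu a) ^+ 2).
  move=> nu'P; apply: le_trans (stationary_gap _ nuS nu'P) _.
  by rewrite [X in X - _]big1 ?sub0r // => a _; rewrite subrr mulr0.
have sq_ge0 nu' : 0 <= \sum_a (nu' a - nu a) ^+ 2.
  by apply: sumr_ge0 => a _; exact: sqr_ge0.
have opt : is_distr nu /\ forall nu', is_distr nu' ->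
    regularized_obj th nu' <= regularized_obj th nu.
  split=> // nu' nu'P; rewrite -subr_le0; apply: le_trans (gap _ nu'P) _.
  by rewrite oppr_le0 mulr_ge0 // invr_ge0 mulr_ge0 // ltW.
apply: get_unique => // nu' [nu'P nu'opt].
apply/funext => a; apply/eqP; rewrite -subr_eq0 -sqrf_eq0; apply/eqP.
have : \sum_a (nu' a - nu a) ^+ 2 <= 0.
  have := le_trans (eqbRL (subr_ge0 _ _) (nu'opt _ nuP)) (gap _ nu'P).
  by rewrite oppr_ge0 pmulr_rle0 // invr_gt0 mulr_gt0.
move=> h; have /eqP : \sum_a (nu' a - nu a) ^+ 2 == 0 by rewrite eq_le h sq_ge0.
by move=> /psumr_eq0P -> // b _; exact: sqr_ge0.
Qed.

(** The inverse of the midpoint between [pmin] and the smallest [q a] works. Having [b] strictly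
    below [pmin^-1] keeps [f1] continuous up to [b]. *)
Let exists_ratio_bound : exists b, (forall a, (q a)^-1 < b) /\ 1 < b < pmin^-1.
Proof.
have [a0 _|A0] := pickP A; last first.
  by have := q_distr.2; rewrite big_pred0 // => /esym/eqP; rewrite oner_eq0.
pose a1 := [arg min_(a < a0) q a]%O.
have a1P a : q a1 <= q a by rewrite /a1; case: arg_minP => // i _; apply.
have p1 : pmin < (pmin + q a1) / 2 by have := q_gt a1; lra.
have p0 := lt_trans pmin_gt0 p1.
have b_gt a : (q a)^-1 < ((pmin + q a1) / 2)^-1.
  by rewrite ltf_pV2 ?posrE //; have := q_gt a1; have := a1P a; lra.
exists ((pmin + q a1) / 2)^-1; split=> //.
rewrite ltf_pV2 ?posrE // p1 andbT (le_lt_trans _ (b_gt a1)) //.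
by rewrite invf_ge1 // distr_le1.
Qed.

(* The multiplier [c] is found by the intermediate value theorem, applied to
   the total mass of [q a * g (th a - c)] where [g] inverts [f'], truncated
   at a level [b] exceeding all the ratios [1 / q a]. *)
Lemma exists_stationary (th : A -> R) : exists c nu, stationary th c nu.
Proof.
have [b [qb /andP[b1 bp]]] := exists_ratio_bound.
have b0 : 0 < b by exact: lt_trans b1.
have inv y : exists x, 0 < x <= b /\ f1 x = Num.min y (f1 b).
  have [x [/andP[x0 xb] fx]] :=
    gen_deriv1_unbounded gen (Num.min y (f1 b)) b0.
  have [||z] := @IVT _ f1 x b (Num.min y (f1 b)) (ltW xb).
  - exact: within_gen_deriv1_continuous gen _ _ x0 bp.
  - by rewrite ge_min (ltW fx) le_max !ge_min lexx !orbT.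
  rewrite in_itv /= => /andP[xz zb] fz; exists z.
  by rewrite (lt_le_trans x0 xz).
have [g gP] := choice inv.
have g0 y : 0 < g y by have [/andP[]] := gP y.
have gb y : g y <= b by have [/andP[]] := gP y.
have gE y : f1 (g y) = Num.min y (f1 b) by have [] := gP y.
have f1_le x y : 0 < x -> x <= b -> 0 < y -> y <= b -> f1 x <= f1 y -> x <= y.
  move=> x0 xb y0 yb; apply: contra_le => yx.
  exact: gen_deriv1_lt pmin_gt0 gen _ _ y0 yx (le_lt_trans xb bp).
(* On []0, b]] the slopes of [f1] are at least [1 / L], so its truncated inverse [g] is
   [L]-Lipschitz, hence continuous. *)
pose L := omega * b.
have L0 : 0 < L by rewrite mulr_gt0.
have g_lip y y' : `|g y - g y'| <= L * `|y - y'|.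
  wlog gyy' : y y' / g y' < g y.
    move=> H; have [lt|lt|->] := ltgtP (g y) (g y'); last 1 first.
    - by rewrite subrr normr0 mulr_ge0 // ltW.
    - by rewrite distrC [X in _ * X]distrC; exact: H.
    - exact: H.
  have := @gen_deriv1_incr _ _ _ _ _ _ pmin_gt0 gen L^-1 (g y') (g y) (g0 y') gyy'
    (le_lt_trans (gb y) bp).
  rewrite -mulrA -ler_pdivlMl ?invr_gt0 // invrK mulr1 ler_pM2l // => /(_ (gb y)).
  rewrite -ler_pdivlMl ?invr_gt0 // invrK !gE => h.
  rewrite gtr0_norm ?subr_gt0 //; apply: le_trans h _; rewrite ler_pM2l //.
  have [yy'|yy'] := leP y y'.
    by apply: le_trans (normr_ge0 _); rewrite subr_le0 le_min !ge_min yy' lexx ?orbT.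
  rewrite gtr0_norm ?subr_gt0 // !minEle; case: (leP y (f1 b)) => ?;
    case: (leP y' (f1 b)) => ?; lra.
have g_cont : continuous g.
  move=> y; apply/cvgrPdist_le => e e0; near=> t.
  apply: le_trans (g_lip _ _) _; rewrite mulrC -ler_pdivlMr //.
  by near: t; apply: (@cvgr_dist_le _ _ _ _ _ id) => //; exact: divr_gt0.
pose G c := \sum_a q a * g (th a - c).
have G_cont : continuous G.
  move=> c; rewrite /G; apply: cvg_big => [|a _]; first exact: add_continuous.
  apply: cvgM; first exact: cvg_cst.
  apply: (@continuous_comp _ _ _ (fun c => th a - c) g); last exact: g_cont.
  by apply: cvgB; [exact: cvg_cst|exact: cvg_id].
pose K : R := \sum_a `|th a|.
have thK a : `|th a| <= K.
  by rewrite /K (bigD1 a) //= lerDl sumr_ge0.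
(* At [c0] every argument of [g] is at least [f1 b], so the mass is [b > 1]; at [c1] every argument
   is at most [f1 1], so the mass is at most 1. *)
pose c0 : R := - K - f1 b; pose c1 : R := K - f1 1.
have f1b : f1 1 < f1 b by apply: gen_deriv1_lt pmin_gt0 gen _ _ ltr01 b1 bp.
have K0 : 0 <= K by exact: sumr_ge0.
have Gc0 : 1 <= G c0.
  rewrite /G (eq_bigr (fun a => q a * b)) => [|a _].
    by rewrite distr_const // ltW.
  congr (_ * _); apply/eqP; rewrite eq_le gb f1_le // gE min_r //.
  by rewrite /c0; have := thK a; rewrite ler_norml => /andP[]; lra.
have Gc1 : G c1 <= 1.
  rewrite -(distr_const 1 q_distr); apply: ler_sum => a _.
  rewrite ler_pM2l //; apply: f1_le => //; first exact: ltW.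
  rewrite gE ge_min; apply/orP; left.
  by rewrite /c1; have := thK a; rewrite ler_norml => /andP[]; lra.
have [|||c _ Gc] := @IVT _ G c0 c1 1.
- by rewrite /c0 /c1; lra.
- exact: continuous_subspaceT.
- by rewrite ge_min Gc1 orbT le_max Gc0.
exists c, (fun a => q a * g (th a - c)).
have nu0 a : 0 < q a * g (th a - c) by rewrite mulr_gt0.
have nuP : is_distr (fun a => q a * g (th a - c)).
  by split=> // a; exact: ltW.
(* The truncation is inactive at the solution: otherwise the ratio would be [b], which exceeds
   [1 / q a], and the mass at [a] would exceed 1. *)
split=> // a; rewrite mulrC mulKf // gE /Num.min; case: ltP => // h.
have gbE : g (th a - c) = b.
  by apply/eqP; rewrite eq_le gb f1_le // gE min_r.
have := distr_le1 a nuP; rewrite gbE mulrC -ler_pdivlMr // div1r.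
by move=> /(lt_le_trans (qb a)); rewrite ltxx.
Unshelve. all: by end_near.
Qed.

Lemma state_softargmaxP (th : A -> R) : exists c, stationary th c (state_softargmax th).
Proof.
have [c [nu nuP]] := exists_stationary th.
by exists c; rewrite (stationary_softargmax nuP).
Qed.

Lemma state_softargmax_distr (th : A -> R) : is_distr (state_softargmax th).
Proof. by have [c []] := state_softargmaxP th. Qed.

Lemma state_softargmax_gt0 (th : A -> R) a : 0 < state_softargmax th a.
Proof. by have [c []] := state_softargmaxP th. Qed.

Lemma ratio_softargmax (th : A -> R) a : 0 < state_softargmax th a / q a < pmin^-1.
Proof.
rewrite divr_gt0 ?state_softargmax_gt0 //=.
by have /andP[] := distr_ratio_lt a (state_softargmax_distr th).
Qed.


Definition set_coord (th : A -> R) (a0 : A) (x : R) : A -> R :=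
  fun a => if a == a0 then x else th a.

Lemma set_coord_id (th : A -> R) a0 : set_coord th a0 (th a0) = th.
Proof. by apply/funext => a; rewrite /set_coord; case: eqP => [->|]. Qed.

(** Add the gap inequalities in both directions, both for the new objective: the objectives cancel,
    the quadratic terms add up, and the linear term reduces to the coordinate [a0]. The resulting
    Hölder bound provides the continuity needed for differentiation. *)
Lemma softargmax_set_coord_lip (th : A -> R) a0 x a :
  (state_softargmax (set_coord th a0 x) a - state_softargmax th a) ^+ 2 <=
  omega * `|x - th a0|.
Proof.
set th' := set_coord th a0 x.
have [c nuS] := state_softargmaxP th; have [c' nuS'] := state_softargmaxP th'.
set nu := state_softargmax th in nuS *; set nu' := state_softargmax th' in nuS' *.
have [nuP nu'P] : is_distr nu /\ is_distr nu' by case: nuS nuS' => [? _ _] [].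
have h := stationary_gap th' nuS nu'P; have h' := stationary_gap th' nuS' nuP.
have sumE : \sum_b (nu' b - nu b) * (th' b - th b) = (nu' a0 - nu a0) * (x - th a0).
  rewrite (bigD1 a0) //= big1 ?addr0 /th' /set_coord ?eqxx // => b /negPf ->.
  by rewrite subrr mulr0.
have sum0 : \sum_b (nu b - nu' b) * (th' b - th' b) = 0.
  by rewrite big1 // => b _; rewrite subrr mulr0.
rewrite sumE in h; rewrite sum0 sub0r in h'.
have le_sum : (nu' a - nu a) ^+ 2 <= \sum_b (nu' b - nu b) ^+ 2.
  by rewrite (bigD1 a) //= lerDl sumr_ge0 // => b _; exact: sqr_ge0.
have sumC : \sum_b (nu b - nu' b) ^+ 2 = \sum_b (nu' b - nu b) ^+ 2.
  by apply: eq_bigr => b _; rewrite -[in RHS]opprB sqrrN.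
apply: le_trans le_sum _; rewrite -ler_pdivrMl //.
have le_abs : (nu' a0 - nu a0) * (x - th a0) <= `|x - th a0|.
  apply: le_trans (ler_norm _) _; rewrite normrM ler_piMl // ler_norml.
  have := distr_le1 a0 nuP; have := distr_le1 a0 nu'P.
  by have := nuP.1 a0; have := nu'P.1 a0; lra.
have -> : omega^-1 = (2 * omega)^-1 + (2 * omega)^-1 by field; exact: lt0r_neq0.
by rewrite sumC in h'; lra.
Qed.

Lemma softargmax_set_coord_cvg (th : A -> R) a0 a :
  state_softargmax (set_coord th a0 x) a @[x --> th a0] --> state_softargmax th a.
Proof.
apply/cvgrPdist_lt => e e0; near=> x.
rewrite distrC -(ltr_pXn2r (isT : (0 < 2)%N)) ?nnegrE ?(ltW e0) // real_normK ?num_real //.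
apply: le_lt_trans (softargmax_set_coord_lip th a0 x a) _.
rewrite mulrC -ltr_pdivlMr // distrC.
near: x; apply: (@cvgr_dist_lt _ _ _ _ _ id) => //.
by rewrite divr_gt0 // exprn_gt0.
Unshelve. all: by end_near.
Qed.

(** Implicit differentiation in Carathéodory form: with slopes of [f1] in place of [f2], the
    increment formula is exact for every [x], and continuity of the softargmax passes it to the
    limit. *)
Lemma softargmax_is_derive (th : A -> R) a0 a :
  let r b := q b / f2 (state_softargmax th b / q b) in
  is_derive (th a0) 1 (fun x => state_softargmax (set_coord th a0 x) a)
    (r a * ((a == a0)%:R - r a0 / \sum_b r b)).
Proof.
set nu := state_softargmax th => r.
have nu_in b : 0 < nu b / q b < pmin^-1 by exact: ratio_softargmax.
have f2_gt0 b : 0 < f2 (nu b / q b) by exact: gen_deriv2_gt0 pmin_gt0 gen _ (nu_in b).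
have slope b : exists g : R -> R,
    [/\ forall z, f1 z - f1 (nu b / q b) = g z * (z - nu b / q b),
        {for nu b / q b, continuous g} & g (nu b / q b) = f2 (nu b / q b)].
  by apply/is_derive1_caratheodory; exact: (steep_is_derive2 gen).
have [g gP] := choice slope.
(* Strict monotonicity of [f1] makes the slopes positive, so they can be divided by. *)
have g_gt0 b z : 0 < z < pmin^-1 -> 0 < g b z.
  move=> /andP[z0 z1]; have [gE _ g_at] := gP b; have /andP[u0 u1] := nu_in b.
  have [zu|uz|->] := ltgtP z (nu b / q b); last by rewrite g_at.
  - have := gen_deriv1_lt pmin_gt0 gen z0 zu u1.
    by rewrite -subr_lt0 gE nmulr_llt0 ?subr_lt0.
  - have := gen_deriv1_lt pmin_gt0 gen u0 uz z1.
    by rewrite -subr_gt0 gE pmulr_lgt0 ?subr_gt0.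
pose nux x := state_softargmax (set_coord th a0 x).
pose rx b x := q b / g b (nux x b / q b).
have rx_gt0 b x : 0 < rx b x by rewrite divr_gt0 // g_gt0 // ratio_softargmax.
have nuxE x b : nux x b - nu b =
    rx b x * ((b == a0)%:R - rx a0 x / \sum_b rx b x) * (x - th a0).
  have [c [nuP _ nuE]] := state_softargmaxP th.
  have [c' [nu'P _ nuE']] := state_softargmaxP (set_coord th a0 x).
  have diffE b' : nux x b' - nu b' = rx b' x * ((b' == a0)%:R * (x - th a0) - (c' - c)).
    have [gE _ _] := gP b'; have := gE (nux x b' / q b').
    rewrite nuE nuE' => gE'.
    have -> : (b' == a0)%:R * (x - th a0) - (c' - c) =
        set_coord th a0 x b' - c' - (th b' - c).
      by rewrite /set_coord; case: eqP => [->|_] /=; ring.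
    have gn0 : g b' (nux x b' / q b') != 0 by rewrite gt_eqF // g_gt0 // ratio_softargmax.
    by rewrite gE' /rx; field; rewrite q_neq0.
  have sum_rx : 0 < \sum_b rx b x.
    by rewrite (bigD1 a0) //= ltr_pwDl // sumr_ge0 // => i _; rewrite ltW.
  (* The increments of the probabilities sum to 0, which determines the change [c' - c] of the
     multiplier. *)
  have : rx a0 x * (x - th a0) = (c' - c) * \sum_b rx b x.
    apply/eqP; rewrite -subr_eq0; apply/eqP.
    transitivity (\sum_b (nux x b - nu b)); last by rewrite sumrB nuP.2 nu'P.2 subrr.
    rewrite [RHS](eq_bigr (fun b => rx b x * ((b == a0)%:R * (x - th a0)) -
      rx b x * (c' - c))) => [|b' _]; last by rewrite diffE mulrBr.
    rewrite sumrB -mulr_suml [X in _ - X = _]mulrC; congr (_ - _).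
    by rewrite (bigD1 a0) //= big1 ?addr0 ?eqxx ?mul1r // => i /negPf ->; rewrite mul0r mulr0.
  move=> cE; rewrite diffE -mulrA; congr (_ * _); rewrite mulrBl; congr (_ - _).
  by rewrite mulrAC cE mulfK // gt_eqF.
apply/is_derive1_caratheodory.
exists (fun x => rx a x * ((a == a0)%:R - rx a0 x / \sum_b rx b x)).
have rx_at b : rx b (th a0) = r b.
  by rewrite /rx /nux set_coord_id; have [_ _ ->] := gP b.
have rx_cvg b : rx b x @[x --> th a0] --> r b.
  apply: cvgM; first exact: cvg_cst.
  apply: cvgV; first by rewrite gt_eqF.
  have [_ gc <-] := gP b.
  have nux_cvg : nux x b / q b @[x --> th a0] --> nu b / q b.
    by apply: cvgM; [exact: softargmax_set_coord_cvg|exact: cvg_cst].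
  exact: cvg_comp nux_cvg gc.
split.
- by move=> x; rewrite set_coord_id nuxE.
- rewrite /prop_for /continuous_at !rx_at (eq_bigr r) => [|b _]; last exact: rx_at.
  apply: cvgM => //; apply: cvgB; first exact: cvg_cst.
  apply: cvgM => //; apply: cvgV; last by apply: cvg_big => // ; exact: add_continuous.
  rewrite gt_eqF // (bigD1 a0) //= ltr_pwDl ?divr_gt0 // sumr_ge0 // => i _.
  by rewrite ltW ?divr_gt0.
- by rewrite !rx_at (eq_bigr r) => [|b _]; [|exact: rx_at].
Qed.

End softargmax.

(** * Discounted linear equations and random variables with finite range *)

Section bellman.
Context (R : realType) (S : finType) (K : S -> S -> R) (gam : R).
Hypotheses (K_distr : forall s, is_distr (K s)) (gam_ge0 : 0 <= gam) (gam_lt1 : gam < 1).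

(** Maximum principle: at a maximizer [m] of [V], averaging gives [V m <= g + gam * V m]. *)
Lemma bellman_le (V : S -> R) (g : R) :
  (forall s, V s <= g + gam * \sum_y K s y * V y) -> forall s, V s <= g / (1 - gam).
Proof.
move=> VE s; pose m := [arg max_(i > s) V i]%O.
have mP i : V i <= V m by rewrite /m; case: arg_maxP => // j _; apply.
apply: le_trans (mP s) _; rewrite ler_pdivlMr ?subr_gt0 // mulrBr mulr1 lerBlDr.
apply: le_trans (VE m) _; rewrite lerD2l mulrC ler_wpM2r //.
rewrite -(distr_const (V m) (K_distr m)); apply: ler_sum => y _.
by rewrite ler_wpM2l // (K_distr m).1.
Qed.

Lemma bellman_ge0 (V : S -> R) :
  (forall s, gam * \sum_y K s y * V y <= V s) -> forall s, 0 <= V s.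
Proof.
move=> VE s; have := @bellman_le (fun s => - V s) 0 _ s.
rewrite mul0r oppr_le0; apply=> {}s; rewrite add0r.
under eq_bigr do rewrite mulrN.
by rewrite sumrN mulrN lerN2.
Qed.

Lemma bellman_eq0 (V : S -> R) :
  (forall s, V s = gam * \sum_y K s y * V y) -> forall s, V s = 0.
Proof.
move=> VE s; apply/eqP; rewrite eq_le; apply/andP; split.
  by rewrite -(mul0r (1 - gam)^-1); apply: bellman_le => {}s; rewrite add0r -VE.
by apply: bellman_ge0 => {}s; rewrite -VE.
Qed.

Lemma bellman_solution (c : S -> R) :
  exists V : S -> R, forall s, V s = c s + gam * \sum_y K s y * V y.
Proof.
(* [B] is the transpose of the identity minus [gam * K], since vectors are rows. Uniqueness of
   solutions makes it injective, hence invertible. *)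
pose B : 'M[R]_#|S| := \matrix_(i, j)
  ((i == j)%:R - gam * K (enum_val j) (enum_val i)).
have mulB (v : 'rV[R]_#|S|) s : (v *m B) 0 (enum_rank s) =
    v 0 (enum_rank s) - gam * \sum_y K s y * v 0 (enum_rank y).
  rewrite !mxE (eq_bigr (fun i => v 0 i * (i == enum_rank s)%:R -
    gam * (K s (enum_val i) * v 0 i))) => [|i _]; last first.
    by rewrite mxE enum_rankK; ring.
  rewrite sumrB (bigD1 (enum_rank s)) //= eqxx mulr1 big1 ?addr0 => [|i /negPf ->].
    rewrite -mulr_sumr; congr (_ - _ * _).
    rewrite (reindex enum_rank) /=; first by apply: eq_bigr => y _; rewrite enum_rankK.
    by exists enum_val => y _; [exact: enum_rankK|exact: enum_valK].
  by rewrite mulr0.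
have B_unit : B \in unitmx.
  rewrite -row_free_unit; apply: inj_row_free => v vB0.
  have v_eq0 : forall s, v 0 (enum_rank s) = 0.
    by apply: bellman_eq0 => s; apply/eqP; rewrite -subr_eq0 -mulB vB0 mxE.
  by apply/rowP => i; rewrite mxE -(enum_valK i) v_eq0.
pose v : 'rV[R]_#|S| := \row_i c (enum_val i) *m invmx B.
exists (fun s => v 0 (enum_rank s)) => s.
have := mulB v s; rewrite /v mulmxKV // mxE enum_rankK => ->.
by rewrite subrK.
Qed.

End bellman.

(** * Integrals and partitions induced by random variables with finite range *)

Section finite_range.
Context (R : realType) (d : measure_display) (Omega : measurableType d).
Context (P : probability Omega R) (T : finType) (g : Omega -> T).
Hypothesis g_meas : forall x, measurable [set w | g w = x].

Lemma finite_range_indic (F : T -> R) w :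
  F (g w) = \sum_x F x * \1_[set w | g w = x] w.
Proof.
rewrite (bigD1 (g w)) //= indicE mem_set // mulr1 big1 ?addr0 // => x gx.
by rewrite indicE memNset ?mulr0 // => /= gwx; rewrite gwx eqxx in gx.
Qed.

Lemma finite_range_measurable (F : T -> R) :
  measurable_fun [set: Omega] (fun w => F (g w)).
Proof.
rewrite (_ : (fun w => _) = fun w => \sum_x F x * \1_[set w | g w = x] w); last first.
  by apply/funext => w; exact: finite_range_indic.
apply: measurable_sum => x; apply: measurable_funM; first exact: measurable_cst.
exact: measurable_indic.
Qed.

Lemma finite_range_integrable (F : T -> R) :
  P.-integrable [set: Omega] (fun w => (F (g w))%:E).
Proof.
have : P.-integrable [set: Omega]
    (fun w => \sum_x ((F x)%:E * (\1_[set w | g w = x] w)%:E))%E.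
  apply: integrable_sum => // x _; apply: integrableZl => //.
  exact: integrable_indic.
apply: eq_integrable => // w _; rewrite (finite_range_indic F w) -sumEFin.
by apply: eq_bigr => x _; rewrite EFinM.
Qed.

Lemma finite_range_integral (F : T -> R) :
  (\int[P]_w (F (g w))%:E = (\sum_x F x * fine (P [set w | g w = x]))%:E)%E.
Proof.
transitivity (\int[P]_w (\sum_x ((F x)%:E * (\1_[set w | g w = x] w)%:E)))%E.
  apply: eq_integral => w _; rewrite (finite_range_indic F w) -sumEFin.
  by apply: eq_bigr => x _; rewrite EFinM.
rewrite integral_sum // => [|x]; last first.
  by apply: integrableZl => //; exact: integrable_indic.
rewrite -sumEFin; apply: eq_bigr => x _.
rewrite integralZl //; last exact: integrable_indic.
by rewrite integral_indic // setIT EFinM fineK // fin_num_measure.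
Qed.

Lemma finite_range_partition (E : set Omega) : measurable E ->
  fine (P E) = \sum_x fine (P ([set w | g w = x] `&` E)).
Proof.
move=> mE; apply: EFin_inj; rewrite fineK ?fin_num_measure // -sumEFin.
transitivity (\int[P]_w (\sum_x (\1_([set w | g w = x] `&` E) w)%:E))%E.
  rewrite -[E in LHS]setIT -integral_indic //; apply: eq_integral => w _.
  rewrite sumEFin; congr (_%:E).
  rewrite (eq_bigr (fun x => \1_E w * \1_[set w | g w = x] w)) => [|x _].
    by rewrite -(finite_range_indic (fun=> \1_E w)).
  by rewrite indicI /= mulrC.
rewrite integral_sum // => [|x]; last by apply: integrable_indic; exact: measurableI.
apply: eq_bigr => x _.
by rewrite integral_indic ?setIT ?fineK ?fin_num_measure //; exact: measurableI.
Qed.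

End finite_range.

(** * Evaluation of a policy *)

Definition policy_kernel (R : realType) (S A : finType) (M : regularized_mdp R S A)
  (pi : S -> A -> R) (s s' : S) : R := \sum_a pi s a * trans M s a s'.

Definition policy_reward (R : realType) (S A : finType) (M : regularized_mdp R S A)
  (f : R -> R) (pi : S -> A -> R) (s : S) : R :=
  \sum_a pi s a * reward M s a - temp M * fdiv f (pi s) (ref M s).

Lemma policy_kernel_distr (R : realType) (S A : finType) (M : regularized_mdp R S A)
  (pi : S -> A -> R) s : is_policy pi -> is_distr (policy_kernel M pi s).
Proof.
move=> piP; split=> [s'|].
  by apply: sumr_ge0 => a _; rewrite mulr_ge0 ?(piP s).1 ?(trans_distr M s a).1.
rewrite /policy_kernel exchange_big /= -[RHS](piP s).2; apply: eq_bigr => a _.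
by rewrite -mulr_sumr (trans_distr M s a).2 mulr1.
Qed.

Section process.
Context (R : realType) (S A : finType) (M : regularized_mdp R S A).
Context (d : measure_display) (Omega : measurableType d) (X : trajectories M Omega).
Context (pi : S -> A -> R) (s0 : S).
Hypothesis pi_policy : is_policy pi.

Local Notation P := (traj_law X pi s0).
Local Notation gam := (discount M).

Let stateE t x := [set w | St X t w = x].
Let actionE t x a := [set w | St X t w = x /\ At X t w = a].

Let measurable_action t x a : measurable (actionE t x a).
Proof.
by rewrite /actionE; apply: measurableI; [exact: measurable_St|exact: measurable_At].
Qed.

Lemma measurable_hist t h : measurable (hist X t h).
Proof.
have -> : hist X t h =
    \bigcap_(k in [set k | (k < t)%N]) actionE k (h k).1 (h k).2 by [].
by apply: bigcap_measurableType => k _; exact: measurable_action.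
Qed.

(** Histories of length [t] form a finite type once encoded as finite functions; padding by [x0]
    gives the infinite sequences expected by [hist], which reads only the first [t] terms. *)
Definition extend_history t (x0 : S * A) (h : {ffun 'I_t -> S * A}) (k : nat) : S * A :=
  if insub k is Some i then h i else x0.

Lemma extend_historyE t x0 (h : {ffun 'I_t -> S * A}) (i : 'I_t) :
  extend_history x0 h i = h i.
Proof. by rewrite /extend_history valK. Qed.

(** The laws of the process are conditional on full histories; summing over histories turns them
    into laws for [St] and [At] at a given time. *)
Lemma hist_partition x0 t E : measurable E ->
  fine (P E) = \sum_(h : {ffun 'I_t -> S * A})
    fine (P (hist X t (extend_history x0 h) `&` E)).
Proof.
move=> mE; pose g w := [ffun k : 'I_t => (St X k w, At X k w)].
have gE (h : {ffun 'I_t -> S * A}) :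
    [set w | g w = h] = hist X t (extend_history x0 h).
  apply/seteqP; split=> w /=.
    move=> <- k kt; have -> : k = Ordinal kt by [].
    by rewrite extend_historyE ffunE.
  move=> hw; apply/ffunP => i; rewrite ffunE.
  have [] := hw i (ltn_ord i); rewrite extend_historyE => -> ->.
  by rewrite -surjective_pairing.
rewrite (@finite_range_partition _ _ _ P _ g) => [|h|//]; last first.
  by rewrite gE; exact: measurable_hist.
by apply: eq_bigr => h _; rewrite gE.
Qed.

Let fineP (E : set Omega) : measurable E -> P E = (fine (P E))%:E.
Proof. by move=> mE; rewrite fineK // fin_num_measure. Qed.

Lemma action_prob t x a :
  fine (P (actionE t x a)) = fine (P (stateE t x)) * pi x a.
Proof.
rewrite (hist_partition (x, a) t) // [in RHS](hist_partition (x, a) t); last first.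
  exact: measurable_St.
rewrite mulr_suml; apply: eq_bigr => h _.
rewrite /actionE law_action // fineM // fin_num_measure //.
by apply: measurableI; [exact: measurable_hist|exact: measurable_St].
Qed.

Lemma transition_prob t x a y :
  fine (P (actionE t x a `&` stateE t.+1 y)) =
  fine (P (actionE t x a)) * trans M x a y.
Proof.
have mS : measurable (stateE t.+1 y) by exact: measurable_St.
rewrite (hist_partition (x, a) t.+1); last exact: measurableI.
rewrite [in RHS](hist_partition (x, a) t.+1) // mulr_suml; apply: eq_bigr => h _.
set h' := extend_history _ h.
(* A history of length [t.+1] already records time [t], so its event is either contained in
   [actionE t x a] or disjoint from it. *)
have [hE|hE] := eqVneq (h' t) (x, a).
  have sub : hist X t.+1 h' `<=` actionE t x a.
    by move=> w /(_ t (ltnSn t)); rewrite hE.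
  rewrite setIA [hist _ _ _ `&` actionE _ _ _]setIidl //.
  rewrite law_state // hE /= fineM // fin_num_measure //; exact: measurable_hist.
have disj : hist X t.+1 h' `&` actionE t x a = set0.
  apply/seteqP; split=> // w [/(_ t (ltnSn t)) [e1 e2]] [e3 e4].
  by move/eqP: hE; apply; rewrite [h' t]surjective_pairing -e1 -e2 e3 e4.
by rewrite setIA disj set0I measure0 /= mul0r.
Qed.

Let pair_meas t (xa : S * A) : measurable [set w | (St X t w, At X t w) = xa].
Proof.
case: xa => x a; rewrite (_ : [set w | _] = actionE t x a) //.
by rewrite /actionE; apply/seteqP; split=> w /= [-> ->].
Qed.

Let pairE t (xa : S * A) :
  [set w | (St X t w, At X t w) = xa] = actionE t xa.1 xa.2.
Proof. by case: xa => x a; rewrite /actionE; apply/seteqP; split=> w /= [-> ->]. Qed.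

Lemma state_prob_succ t y : fine (P (stateE t.+1 y)) =
  \sum_x fine (P (stateE t x)) * policy_kernel M pi x y.
Proof.
rewrite (@finite_range_partition _ _ _ P _ _ (pair_meas t)); last exact: measurable_St.
transitivity (\sum_xa fine (P (stateE t xa.1)) * pi xa.1 xa.2 * trans M xa.1 xa.2 y).
  by apply: eq_bigr => xa _; rewrite pairE transition_prob action_prob.
rewrite -(pair_bigA _ (fun x a => fine (P (stateE t x)) * pi x a * trans M x a y)) /=.
by apply: eq_bigr => x _; rewrite mulr_sumr; apply: eq_bigr => a _; rewrite mulrA.
Qed.

Lemma action_integral t (F : S -> A -> R) :
  (\int[P]_w (F (St X t w) (At X t w))%:E =
   (\sum_x fine (P (stateE t x)) * \sum_a pi x a * F x a)%:E)%E.
Proof.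
rewrite (@finite_range_integral _ _ _ P _ _ (pair_meas t) (fun xa => F xa.1 xa.2)).
congr (_%:E).
transitivity (\sum_xa fine (P (stateE t xa.1)) * pi xa.1 xa.2 * F xa.1 xa.2).
  by apply: eq_bigr => xa _; rewrite pairE action_prob mulrC.
rewrite -(pair_bigA _ (fun x a => fine (P (stateE t x)) * pi x a * F x a)) /=.
by apply: eq_bigr => x _; rewrite mulr_sumr; apply: eq_bigr => a _; rewrite mulrA.
Qed.

Lemma state_prob_start (V : S -> R) : \sum_x fine (P (stateE 0%N x)) * V x = V s0.
Proof.
have p1 : fine (P (stateE 0%N s0)) = 1 by rewrite /stateE law_start.
have p0 x : 0 <= fine (P (stateE 0%N x)) by rewrite fine_ge0.
have : fine (P setT) = \sum_x fine (P (stateE 0%N x)).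
  rewrite (@finite_range_partition _ _ _ P _ _ (measurable_St X 0%N)) //.
  by apply: eq_bigr => x _; rewrite setIT.
rewrite probability_setT /= (bigD1 s0) //= p1 => /eqP.
rewrite addrC -subr_eq subrr eq_sym => /eqP/psumr_eq0P rest.
rewrite (bigD1 s0) //= p1 mul1r big1 ?addr0 // => x xs.
by rewrite rest ?mul0r.
Qed.

Lemma state_prob_bound t (V : S -> R) :
  `|\sum_x fine (P (stateE t x)) * V x| <= \sum_x `|V x|.
Proof.
apply: le_trans (ler_norm_sum _ _ _) _; apply: ler_sum => x _.
have mE : measurable (stateE t x) by exact: measurable_St.
rewrite normrM ler_piMl // ger0_norm ?fine_ge0 //.
by rewrite -lee_fin -fineP // probability_le1.
Qed.

(* The process V(S_t) discounted by gam^t, compensated by the rewards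
   collected so far, has constant expectation. *)
Lemma bellman_telescope (c V : S -> R) n :
  (forall s, V s = c s + gam * \sum_y policy_kernel M pi s y * V y) ->
  \sum_(0 <= t < n) gam ^+ t * (\sum_x fine (P (stateE t x)) * c x) =
  V s0 - gam ^+ n * \sum_x fine (P (stateE n x)) * V x.
Proof.
move=> VE; elim: n => [|n IHn].
  by rewrite big_geq // expr0 mul1r state_prob_start subrr.
rewrite big_nat_recr //= IHn exprS.
have -> : \sum_x fine (P (stateE n.+1 x)) * V x =
    \sum_x fine (P (stateE n x)) * \sum_y policy_kernel M pi x y * V y.
  under eq_bigr do rewrite state_prob_succ mulr_suml.
  rewrite exchange_big /=; apply: eq_bigr => x _; rewrite mulr_sumr.
  by apply: eq_bigr => y _; rewrite mulrA.
have -> : \sum_x fine (P (stateE n x)) * c x =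
    \sum_x fine (P (stateE n x)) * V x -
    gam * \sum_x fine (P (stateE n x)) * \sum_y policy_kernel M pi x y * V y.
  rewrite mulr_sumr -sumrB; apply: eq_bigr => x _; rewrite {1}VE; ring.
ring.
Qed.

(** The expected partial returns telescope to [V s0] minus a remainder of order [gam ^+ n].
    Dominated convergence, with bound [C / (1 - gam)], identifies their limit with the expected
    return. *)
Lemma value_bellman (f : R -> R) (V : S -> R) :
  (forall s, V s = policy_reward M f pi s + gam * \sum_y policy_kernel M pi s y * V y) ->
  value X f pi s0 = V s0.
Proof.
move=> VE; have /andP[gam0 gam1] := discount_bounds M.
pose F x a := reward M x a - temp M * fdiv f (pi x) (ref M x).
pose C : R := \sum_x \sum_a `|F x a|.
have FC x a : `|F x a| <= C.
  rewrite /C (bigD1 x) //= (bigD1 a) //= -addrA lerDl.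
  by rewrite addr_ge0 // sumr_ge0 // => ? _; rewrite sumr_ge0.
have C0 : 0 <= C by do 2 apply: sumr_ge0 => ? _.
have FE x : \sum_a pi x a * F x a = policy_reward M f pi x.
  rewrite /F; under eq_bigr do rewrite mulrBr.
  by rewrite sumrB distr_const.
pose u w t := gam ^+ t * F (St X t w) (At X t w).
have u_le w t : `|u w t| <= geometric C gam t.
  have gt : 0 <= gam ^+ t by rewrite exprn_ge0 // ltW.
  by rewrite /u normrM ger0_norm // /geometric /= mulrC ler_wpM2r.
have gam_norm : `|gam| < 1 by rewrite ger0_norm // ltW.
have u_cvg w : series (u w) @ \oo --> discounted_return X f pi w.
  have /cvg_ex[l ul] : cvgn (series (u w)).
    apply: normed_cvg; apply: (@series_le_cvg _ (fun n => `|u w n|) (geometric C gam)).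
    - by move=> n; exact: normr_ge0.
    - by move=> n; rewrite geometric_ge0 // ltW.
    - exact: u_le.
    - exact: is_cvg_geometric_series.
  (* Convergence has been established first, so the infinite sum is a genuine limit and not a
     default value. *)
  have -> // : discounted_return X f pi w = l by exact: cvg_lim ul.
have sum_le n w : `|series (u w) n| <= C / (1 - gam).
  rewrite /series /=; apply: le_trans (ler_norm_sum _ _ _) _.
  apply: le_trans (geometric_le_lim n C0 gam0 gam_norm).
  by apply: ler_sum => t _; exact: u_le.
have u_meas t : measurable_fun [set: Omega] (fun w => u w t).
  exact: (finite_range_measurable (pair_meas t)
    (fun xa => gam ^+ t * F xa.1 xa.2)).
have u_int n : (\int[P]_w (series (u w) n)%:E =
    (V s0 - gam ^+ n * \sum_x fine (P (stateE n x)) * V x)%:E)%E.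
  rewrite -(bellman_telescope n VE) -sumEFin.
  under eq_integral do rewrite /series /= -sumEFin.
  rewrite integral_sum // => [|t].
    apply: eq_bigr => t _.
    rewrite (action_integral t (fun x a => gam ^+ t * F x a)) mulr_sumr.
    congr (_%:E); apply: eq_bigr => x _; rewrite mulrCA -FE; congr (_ * _).
    by rewrite mulr_sumr; apply: eq_bigr => a _; rewrite mulrCA.
  exact: (finite_range_integrable P (pair_meas t)
    (fun xa => gam ^+ t * F xa.1 xa.2)).
have lim_int : (\int[P]_w (series (u w) n)%:E @[n --> \oo] -->
    \int[P]_w (discounted_return X f pi w)%:E)%E.
  apply: (@dominated_cvg _ _ _ _ _ _ _ _ (fun=> (C / (1 - gam))%:E)) => //.
  - by move=> n; apply/measurable_EFinP; apply: measurable_sum => t; exact: u_meas.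
  - by move=> w _; apply: cvg_EFin; [exact: nearW|exact: u_cvg].
  - exact: finite_measure_integrable_cst.
  - by move=> n w _; rewrite abse_EFin lee_fin.
have lim_V : (\int[P]_w (series (u w) n)%:E @[n --> \oo] --> (V s0)%:E)%E.
  under eq_cvg do rewrite u_int.
  apply: cvg_EFin; first exact: nearW.
  rewrite -[X in _ --> X]subr0; apply: cvgB; first exact: cvg_cst.
  apply/norm_cvg0P; pose B : R := \sum_x `|V x|.
  apply: (@squeeze_cvgr _ _ _ _ (fun=> 0) (geometric B gam)).
  - apply: nearW => n; rewrite normr_ge0 normrM /geometric /= mulrC.
    have gn : 0 <= gam ^+ n by rewrite exprn_ge0 // ltW.
    by rewrite (ger0_norm gn) ler_wpM2r // state_prob_bound.
  - exact: cvg_cst.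
  - exact: cvg_geometric.
rewrite /value unlock.
by rewrite (cvg_unique _ lim_int lim_V).
Qed.

End process.

(** * The gradient and the suboptimality gap *)

Lemma is_derive_bigsum (R : realType) (I : finType) (h : I -> R -> R) (dh : I -> R) (x : R) :
  (forall i, is_derive x 1 (h i) (dh i)) ->
  is_derive x 1 (fun y => \sum_i h i y) (\sum_i dh i).
Proof.
move=> hD; have -> : (fun y => \sum_i h i y) = \sum_i h i.
  by apply/funext => y; rewrite fct_sumE.
by elim/big_ind2 : _ => // [|] *; [exact: is_derive_cst|exact: is_deriveD].
Qed.

Definition action_value (R : realType) (S A : finType) (M : regularized_mdp R S A)
  (V : S -> R) (s : S) (a : A) : R :=
  reward M s a + discount M * \sum_y trans M s a y * V y.

Section value.
Context (R : realType) (S A : finType) (M : regularized_mdp R S A).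
Context (d : measure_display) (Omega : measurableType d) (X : trajectories M Omega).
Context (f : R -> R).

Local Notation gam := (discount M).

Let gam_bounds : 0 <= gam /\ gam < 1.
Proof. by have /andP[/ltW] := discount_bounds M. Qed.

Lemma policy_backup (pi : S -> A -> R) (V : S -> R) s :
  policy_reward M f pi s + gam * \sum_y policy_kernel M pi s y * V y =
  \sum_a pi s a * action_value M V s a - temp M * fdiv f (pi s) (ref M s).
Proof.
rewrite /policy_reward /action_value.
rewrite [in RHS](eq_bigr (fun a => pi s a * reward M s a +
  gam * (pi s a * \sum_y trans M s a y * V y))) => [|a _]; last by ring.
rewrite big_split /= -mulr_sumr.
have -> : \sum_a pi s a * \sum_y trans M s a y * V y =
    \sum_y policy_kernel M pi s y * V y.
  under eq_bigr do rewrite mulr_sumr.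
  rewrite exchange_big /=; apply: eq_bigr => y _; rewrite /policy_kernel mulr_suml.
  by apply: eq_bigr => a _; rewrite mulrA.
ring.
Qed.

(** A solution of the evaluation equations exists by linear algebra, and [value_bellman] identifies
    it with the value. *)
Lemma value_backup (pi : S -> A -> R) s : is_policy pi ->
  value X f pi s = \sum_a pi s a * action_value M (value X f pi) s a -
    temp M * fdiv f (pi s) (ref M s).
Proof.
move=> piP; have [V VE] := bellman_solution
  (fun s => policy_kernel_distr M s piP) gam_bounds.1 gam_bounds.2 (policy_reward M f pi).
have -> : value X f pi = V.
  by apply/funext => s'; exact: value_bellman.
by rewrite -policy_backup -VE.
Qed.

(* Changing the policy at the single state [s0] perturbs the evaluation
   equations by a rank one term, so the value moves along the discounted
   occupancy [N] of [s0]. *)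
Lemma value_policy_change (pi pi' : S -> A -> R) (s0 : S) (N : S -> R) :
  is_policy pi -> is_policy pi' -> (forall s, s != s0 -> pi' s = pi s) ->
  (forall s, N s = (s == s0)%:R + gam * \sum_y policy_kernel M pi s y * N y) ->
  let k := \sum_a (pi' s0 a - pi s0 a) * action_value M (value X f pi) s0 a -
    temp M * (fdiv f (pi' s0) (ref M s0) - fdiv f (pi s0) (ref M s0)) in
  let eps := gam * \sum_a (pi' s0 a - pi s0 a) * \sum_y trans M s0 a y * N y in
  forall s, (1 - eps) * (value X f pi' s - value X f pi s) = k * N s.
Proof.
move=> piP pi'P pi_eq NE k eps s.
set v := value X f pi; set v' := value X f pi'.
pose g := \sum_a (pi' s0 a - pi s0 a) * action_value M v' s0 a -
  temp M * (fdiv f (pi' s0) (ref M s0) - fdiv f (pi s0) (ref M s0)).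
have step t : v' t - v t =
    (t == s0)%:R * g + gam * \sum_y policy_kernel M pi t y * (v' y - v y).
  have -> : gam * \sum_y policy_kernel M pi t y * (v' y - v y) =
      (\sum_a pi t a * action_value M v' t a - temp M * fdiv f (pi t) (ref M t)) - v t.
    rewrite [v t]value_backup // -!policy_backup -/v opprD addrACA subrr add0r -mulrBr.
    by rewrite -sumrB; congr (_ * _); apply: eq_bigr => y _; rewrite mulrBr.
  rewrite {1}/v' value_backup // -/v'.
  have [->|ts0] := eqVneq t s0; last by rewrite pi_eq // mul0r add0r.
  rewrite /g; under [X in 1%:R * (X - _)]eq_bigr do rewrite mulrBl.
  by rewrite sumrB; ring.
(* Both sides solve the same discounted linear equation with source [g] at [s0], so uniqueness
   applies. *)
have diffE t : v' t - v t = g * N t.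
  apply/eqP; rewrite -subr_eq0; apply/eqP; move: t.
  apply: (bellman_eq0 (fun s => policy_kernel_distr M s piP) gam_bounds.1 gam_bounds.2) => t.
  rewrite step NE.
  rewrite [in RHS](eq_bigr (fun y => policy_kernel M pi t y * (v' y - v y) -
    g * (policy_kernel M pi t y * N y))) => [|y _]; last by ring.
  by rewrite sumrB -mulr_sumr; ring.
(* [g] involves the new value; substituting [v' = v + g * N] leaves a scalar equation for [g]. *)
have gE : g = k + g * eps.
  rewrite {1}/g /k /eps -/v addrAC; congr (_ - _).
  rewrite !mulr_sumr -big_split /=; apply: eq_bigr => a _.
  rewrite /action_value.
  have -> : \sum_y trans M s0 a y * v' y =
      \sum_y trans M s0 a y * v y + g * \sum_y trans M s0 a y * N y.
    rewrite mulr_sumr -big_split /=; apply: eq_bigr => y _.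
    by rewrite [g * _]mulrCA -diffE; ring.
  ring.
by rewrite diffE mulrBl mul1r {1}gE; ring.
Qed.

End value.

(** * Derivative of the softargmax value, and its comparison with the optimum *)

Section gradient.
Context (R : realType) (S A : finType) (M : regularized_mdp R S A).
Context (d : measure_display) (Omega : measurableType d) (X : trajectories M Omega).
Context (f f1 f2 : R -> R) (pmin omega : R).
Hypotheses (pmin_gt0 : 0 < pmin) (gen : steep_generator f f1 f2 pmin omega).
Hypothesis ref_gt : forall s a, pmin < ref M s a.

Local Notation gam := (discount M).
Local Notation lam := (temp M).
Local Notation smax := (softargmax f (ref M)).

Let gam_bounds : 0 <= gam /\ gam < 1.
Proof. by have /andP[/ltW] := discount_bounds M. Qed.

Let omega_gt0 : 0 < omega := steep_omega_gt0 gen.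

Lemma softargmax_policy (theta : S -> A -> R) : is_policy (smax theta).
Proof.
move=> s; exact: (state_softargmax_distr pmin_gt0 gen (ref_policy M s) (ref_gt s)).
Qed.

Lemma update_state (theta : S -> A -> R) s a x :
  update theta s a x s = set_coord (theta s) a x.
Proof. by apply/funext => b; rewrite /update /set_coord eqxx. Qed.

Lemma update_other (theta : S -> A -> R) s s' a x :
  s' != s -> update theta s a x s' = theta s'.
Proof. by move=> /negPf ss'; apply/funext => b; rewrite /update ss'. Qed.

Variable theta : S -> A -> R.

(** This is [r] of the overview; [tilted_value] and [mean_tilted_value] below are [xi] and
    [xibar]. *)
Definition local_weight (s : S) (a : A) : R :=
  ref M s a / f2 (smax theta s a / ref M s a).

Definition tilted_value (s : S) (a : A) : R :=
  action_value M (value X f (smax theta)) s a - lam * theta s a.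

Definition mean_tilted_value (s : S) : R :=
  (\sum_a local_weight s a * tilted_value s a) / \sum_a local_weight s a.

Lemma local_weight_gt0 s a : 0 < local_weight s a.
Proof.
apply: divr_gt0; first exact: lt_trans (ref_gt s a).
apply: (gen_deriv2_gt0 pmin_gt0 gen).
exact: (ratio_softargmax pmin_gt0 gen (ref_policy M s) (ref_gt s)).
Qed.

Lemma sum_local_weight_gt0 s : A -> 0 < \sum_a local_weight s a.
Proof.
move=> a; rewrite (bigD1 a) //= ltr_pwDl ?local_weight_gt0 // sumr_ge0 // => b _.
by rewrite ltW // local_weight_gt0.
Qed.

(** By [value_policy_change] the increment is exactly [n * k x / (1 - eps x)] near [x0]. Since [k]
    and [eps] vanish at [x0], only the derivative of [k] contributes. *)
Lemma value_param_is_derive s0 a0 : exists n, init M s0 <= n /\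
  is_derive (theta s0 a0) 1 (fun x => value_param X f (update theta s0 a0 x))
    (n * (local_weight s0 a0 * (tilted_value s0 a0 - mean_tilted_value s0))).
Proof.
have piP := softargmax_policy theta.
have [N NE] := bellman_solution (fun s => policy_kernel_distr M s piP)
  gam_bounds.1 gam_bounds.2 (fun s => (s == s0)%:R).
have N_ge0 : forall s, 0 <= N s.
  apply: (bellman_ge0 (fun s => policy_kernel_distr M s piP) gam_bounds.1 gam_bounds.2).
  by move=> s; rewrite [leRHS]NE lerDr ler0n.
have N_ge1 : 1 <= N s0.
  rewrite NE eqxx lerDl mulr_ge0 ?gam_bounds.1 // sumr_ge0 // => y _.
  by rewrite mulr_ge0 // (policy_kernel_distr M s0 piP).1.
(* The discounted occupancy of [s0] from the initial law; the visit at time 0, [N s0 >= 1], gives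
   the lower bound. *)
pose n := \sum_s init M s * N s; exists n; split.
  rewrite /n (bigD1 s0) //= -[leLHS]addr0 lerD ?sumr_ge0 // => [|s _].
    by rewrite ler_peMr // (init_distr M).1.
  by rewrite mulr_ge0 // (init_distr M).1.
set x0 := theta s0 a0; set q := ref M s0.
pose p x := state_softargmax f q (set_coord (theta s0) a0 x).
have p0E : p x0 = smax theta s0 by rewrite /p set_coord_id.
have sumw_gt0 := sum_local_weight_gt0 s0 a0.
set W := \sum_a local_weight s0 a in sumw_gt0.
pose dp a := local_weight s0 a * ((a == a0)%:R - local_weight s0 a0 / W).
have pD a : is_derive x0 1 (fun x => p x a) (dp a).
  exact: (softargmax_is_derive pmin_gt0 gen (ref_policy M s0) (ref_gt s0)).
have q_gt0 a : 0 < q a by exact: lt_trans (ref_gt s0 a).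
(* Pairing with [dp] centers [F] at its weighted mean, hence kills constants. This removes the
   multiplier [c] from the derivative of the divergence below. *)
have dp_sum (F : A -> R) : \sum_a dp a * F a =
    local_weight s0 a0 * (F a0 - (\sum_a local_weight s0 a * F a) / W).
  rewrite (eq_bigr (fun a => (a == a0)%:R * (local_weight s0 a0 * F a0) -
    local_weight s0 a0 / W * (local_weight s0 a * F a))) => [|a _]; last first.
    by rewrite /dp; case: eqP => [->|_] /=; ring.
  rewrite sumrB -mulr_sumr -mulr_suml (bigD1 a0) //= eqxx big1 ?addr0 ?mul1r => [|a /negPf -> //].
  by field; rewrite gt_eqF.
pose Q a := action_value M (value X f (smax theta)) s0 a.
pose T a := \sum_y trans M s0 a y * N y.
pose k x := \sum_a (p x a - p x0 a) * Q a - lam * (fdiv f (p x) q - fdiv f (p x0) q).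
pose eps x := gam * \sum_a (p x a - p x0 a) * T a.
have k0 : k x0 = 0.
  by rewrite /k subrr mulr0 subr0 big1 // => a _; rewrite subrr mul0r.
have eps0 : eps x0 = 0.
  by rewrite /eps big1 ?mulr0 // => a _; rewrite subrr mul0r.
have linD (F : A -> R) :
    is_derive x0 1 (fun x => \sum_a (p x a - p x0 a) * F a) (\sum_a dp a * F a).
  apply: is_derive_bigsum => a; have paD := pD a.
  by apply: is_derive_eq; rewrite /GRing.scale /=; ring.
have fdivD : is_derive x0 1 (fun x => fdiv f (p x) q)
    (\sum_a dp a * theta s0 a).
  have [c [_ _ cE]] :=
    state_softargmaxP pmin_gt0 gen (ref_policy M s0) (ref_gt s0) (theta s0).
  have -> : \sum_a dp a * theta s0 a = \sum_a dp a * (theta s0 a - c).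
    rewrite !dp_sum; congr (_ * _).
    under [in RHS]eq_bigr do rewrite mulrBr.
    by rewrite sumrB -mulr_suml -/W; field; rewrite gt_eqF.
  apply: is_derive_bigsum => a; have paD := pD a; have qa := q_gt0 a.
  have ratioD : is_derive x0 1 (fun x => p x a / q a) (dp a / q a).
    by apply: is_derive_eq; rewrite /GRing.scale /=; ring.
  have fD : is_derive (p x0 a / q a) 1 f (theta s0 a - c).
    rewrite p0E -cE; apply: (steep_is_derive1 gen).
    exact: (ratio_softargmax pmin_gt0 gen (ref_policy M s0) (ref_gt s0)).
  have compD := @is_derive1_comp _ f (fun x => p x a / q a) _ _ _ fD ratioD.
  apply: is_derive_eq; rewrite /GRing.scale /=.
  by field; rewrite gt_eqF.
have kD : is_derive x0 1 k
    (local_weight s0 a0 * (tilted_value s0 a0 - mean_tilted_value s0)).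
  have QD := linD Q; apply: is_derive_eq.
  rewrite /mean_tilted_value -/W -(dp_sum (tilted_value s0)) /GRing.scale /=.
  rewrite subr0 mulr_sumr -sumrB; apply: eq_bigr => a _.
  by rewrite /tilted_value -/(Q a); ring.
have TD := linD T.
have epsD : is_derive x0 1 eps (gam * \sum_a dp a * T a).
  by apply: is_derive_eq; rewrite /GRing.scale /=; ring.
have eps_cont : eps x @[x --> x0] --> 0.
  rewrite -eps0; have [/derivable1_diffP eD _] := epsD.
  exact: differentiable_continuous.
apply: (@near_eq_is_derive _ _ _
    (fun x => value_param X f theta + n * (k x * (1 - eps x)^-1))); last first.
  have eps_neq : 1 - eps x0 != 0 by rewrite eps0 subr0 oner_neq0.
  have invD : is_derive x0 1 (fun x => (1 - eps x)^-1) (gam * \sum_a dp a * T a).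
    have h : is_derive x0 1 (fun x => 1 - eps x) (- (gam * \sum_a dp a * T a)).
      have oneD := is_derive_cst (1 : R) x0 1.
      by have := is_deriveB oneD epsD; rewrite sub0r.
    have := @is_deriveV _ (fun x => 1 - eps x) x0 _ _ eps_neq h.
    rewrite /= eps0 subr0 expr1n invr1 /GRing.scale /=.
    by rewrite mulN1r opprK.
  apply: is_derive_eq.
  by rewrite k0 eps0 subr0 invr1 /GRing.scale /=; ring.
near=> x.
have eps_neq : 1 - eps x != 0.
  rewrite gt_eqF // subr_gt0; near: x; exact: (cvgr_lt _ eps_cont).
pose pi' := smax (update theta s0 a0 x).
have pi'_s0 : pi' s0 = p x by rewrite /pi' /softargmax update_state.
have pi'_other s : s != s0 -> pi' s = smax theta s.
  by move=> ss0; rewrite /pi' /softargmax update_other.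
have change := value_policy_change X f piP (softargmax_policy _) pi'_other NE.
rewrite /value_param /value_init mulrA -[n * k x]mulrC.
rewrite /n mulr_sumr mulr_suml -big_split /=; apply: eq_bigr => s _.
have ch : (1 - eps x) * (value X f pi' s - value X f (smax theta) s) = k x * N s.
  by have := change s; cbv zeta; rewrite -/pi' pi'_s0 -p0E.
have -> : value X f pi' s = value X f (smax theta) s + k x * N s / (1 - eps x).
  by rewrite -ch mulrAC mulfV // mul1r addrC subrK.
by field.
Unshelve. all: by end_near.
Qed.

Lemma softargmax_suboptimality (pi : S -> A -> R) (s : S) : is_policy pi ->
  value X f pi s - value X f (smax theta) s <=
  omega / (2 * lam) *
    (\sum_s' \sum_a (tilted_value s' a - mean_tilted_value s') ^+ 2) / (1 - gam).
Proof.
move=> piP; have tP := softargmax_policy theta; move: s.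
apply: (bellman_le (fun s => policy_kernel_distr M s piP) gam_bounds.1 gam_bounds.2).
move=> s; have lam0 := temp_gt0 M.
set v := value X f pi; set u := value X f (smax theta).
pose Q a := action_value M u s a.
have -> : v s - u s = (\sum_a pi s a * Q a - lam * fdiv f (pi s) (ref M s)) - u s +
    gam * \sum_y policy_kernel M pi s y * (v y - u y).
  rewrite {1}/v value_backup // -/v -!policy_backup.
  rewrite -[X in _ = _ + gam * X](_ : \sum_y policy_kernel M pi s y * v y -
    \sum_y policy_kernel M pi s y * u y = _).
    by ring.
  by rewrite -sumrB; apply: eq_bigr => y _; rewrite mulrBr.
rewrite lerD2r {1}/u value_backup // -/u.
have [c cS] := state_softargmaxP pmin_gt0 gen (ref_policy M s) (ref_gt s) (theta s).
(* After division by [lam], one-step improvement is the one-state problem with linear term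
   [Q / lam], while the current policy is stationary for [theta s]. *)
have := stationary_gap pmin_gt0 gen (ref_gt s) (fun a => Q a / lam) cS (piP s).
rewrite /regularized_obj -[state_softargmax _ _ _]/(smax theta s).
set nu := smax theta s; move=> /(ler_wpM2l (ltW lam0)) gap.
have scale (mu : A -> R) : lam * \sum_a mu a * (Q a / lam) = \sum_a mu a * Q a.
  rewrite mulr_sumr; apply: eq_bigr => a _; field; exact: lt0r_neq0.
have {gap} gap : \sum_a pi s a * Q a - lam * fdiv f (pi s) (ref M s) -
    (\sum_a nu a * Q a - lam * fdiv f nu (ref M s)) <=
    \sum_a ((pi s a - nu a) * (tilted_value s a - mean_tilted_value s) -
      lam / (2 * omega) * (pi s a - nu a) ^+ 2).
  apply: le_trans (_ : _ <= lam * (\sum_a (pi s a - nu a) * (Q a / lam - theta s a) -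
      (2 * omega)^-1 * \sum_a (pi s a - nu a) ^+ 2)) _.
    by apply: le_trans gap; rewrite !mulrBr !scale.
  have sum0 : \sum_a (pi s a - nu a) * mean_tilted_value s = 0.
    by rewrite -mulr_suml sumrB (piP s).2 (tP s).2 subrr mul0r.
  rewrite -[leLHS]subr0 -[X in _ - X <= _]sum0 mulr_sumr -!sumrB mulr_sumr -sumrB.
  rewrite le_eqVlt; apply/orP; left; apply/eqP; apply: eq_bigr => a _.
  by rewrite /tilted_value -/(Q a); field; rewrite !lt0r_neq0.
apply: le_trans gap _.
have sq_ge0 s' : 0 <= \sum_a (tilted_value s' a - mean_tilted_value s') ^+ 2.
  by apply: sumr_ge0 => a _; exact: sqr_ge0.
have c_gt0 : 0 < omega / (2 * lam) by rewrite divr_gt0 // mulr_gt0.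
(* Summing over all states replaces the gain at [s] by a bound independent of [s], as [bellman_le]
   requires. *)
apply: le_trans (_ : _ <= omega / (2 * lam) *
    \sum_a (tilted_value s a - mean_tilted_value s) ^+ 2) _; last first.
  by rewrite ler_pM2l // [leRHS](bigD1 s) //= lerDl sumr_ge0.
rewrite mulr_sumr; apply: ler_sum => a _.
move: (pi s a - nu a) (tilted_value s a - mean_tilted_value s) => x y.
(* Young's inequality, by completing the square. *)
rewrite -subr_ge0 (_ : _ - _ = (lam * x - omega * y) ^+ 2 / (2 * lam * omega)).
  by rewrite divr_ge0 ?sqr_ge0 // !mulr_ge0 // ltW.
by field; rewrite !lt0r_neq0.
Qed.

(** Both sides are compared with [Y]: the squared gradient is at least
    [rho ^+ 2 * zet ^+ 2 * w * Y], and the gap is at most a multiple of [Y]. Their constants differ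
    by a factor [(2 * omega)^-1 <= 1]. *)
Lemma gradient_domination (rho zet w : R) :
  1 <= omega -> 0 <= rho -> (forall s, rho <= init M s) ->
  0 <= zet -> (forall s, zet <= \sum_a local_weight s a) ->
  0 <= w ->
  (forall s a, w <= (1 / (\sum_b local_weight s b) * local_weight s a) ^+ 2) ->
  lam * (1 - gam) * rho ^+ 2 * (zet ^+ 2 / omega ^+ 2) * w *
    (opt_value_init X f - value_param X f theta) <=
  sqnorm2 (gradient (value_param X f) theta).
Proof.
move=> omega1 rho0 rhoP zet0 zetP w0 wP; have lam0 := temp_gt0 M.
have gam1 : 0 < 1 - gam by rewrite subr_gt0 gam_bounds.2.
pose Y := \sum_s \sum_a (tilted_value s a - mean_tilted_value s) ^+ 2.
have Y0 : 0 <= Y by do 2 apply: sumr_ge0 => ? _; exact: sqr_ge0.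
have gapP : opt_value_init X f - value_param X f theta <=
    omega / (2 * lam) * Y / (1 - gam).
  rewrite /opt_value_init /value_param /value_init -sumrB.
  rewrite -(distr_const (omega / (2 * lam) * Y / (1 - gam)) (init_distr M)).
  apply: ler_sum => s _; rewrite -mulrBr ler_wpM2l ?(init_distr M).1 //.
  rewrite lerBlDr /opt_value; apply: ge_sup.
    by exists (value X f (ref M) s), (ref M) => //; exact: ref_policy.
  by move=> _ [pi piP <-]; rewrite -lerBlDr softargmax_suboptimality.
have gradP : rho ^+ 2 * zet ^+ 2 * w * Y <= sqnorm2 (gradient (value_param X f) theta).
  rewrite /sqnorm2 /Y mulr_sumr; apply: ler_sum => s _.
  rewrite mulr_sumr; apply: ler_sum => a _.
  have [n [rho_n nD]] := value_param_is_derive s a.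
  rewrite /gradient derive1E (derive_val (is_derive := nD)).
  have sq3 (x y z : R) : (x * (y * z)) ^+ 2 = x ^+ 2 * y ^+ 2 * z ^+ 2 by ring.
  rewrite sq3 ler_wpM2r ?sqr_ge0 // -mulrA ler_pM ?mulr_ge0 ?sqr_ge0 //.
    rewrite ler_sqr ?nnegrE //; last by rewrite (le_trans rho0) // (le_trans (rhoP s)).
    exact: le_trans (rhoP s) rho_n.
  have W0 := sum_local_weight_gt0 s a.
  (* The local weight is the total weight times the normalized one; [zet] bounds the former below
     and [w] the square of the latter. *)
  have -> : local_weight s a ^+ 2 = (\sum_b local_weight s b) ^+ 2 *
      (1 / (\sum_b local_weight s b) * local_weight s a) ^+ 2.
    by field; rewrite gt_eqF.
  by rewrite ler_pM ?sqr_ge0 // ler_sqr ?nnegrE // ltW.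
apply: le_trans gradP.
have c_ge0 : 0 <= lam * (1 - gam) * rho ^+ 2 * (zet ^+ 2 / omega ^+ 2) * w.
  apply: mulr_ge0 => //; apply: mulr_ge0; last by rewrite divr_ge0 ?sqr_ge0.
  by apply: mulr_ge0; [apply: mulr_ge0; exact: ltW|exact: sqr_ge0].
apply: le_trans (ler_wpM2l c_ge0 gapP) _.
have -> : lam * (1 - gam) * rho ^+ 2 * (zet ^+ 2 / omega ^+ 2) * w *
    (omega / (2 * lam) * Y / (1 - gam)) =
    rho ^+ 2 * zet ^+ 2 * w * Y * (2 * omega)^-1.
  by field; rewrite !gt_eqF.
rewrite ler_piMr ?mulr_ge0 ?sqr_ge0 // invf_le1 ?mulr_gt0 //; lra.
Qed.

End gradient.

(** It remains to see that the infima in [mu] are lower bounds of their sets and nonnegative: each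
    set is nonempty and bounded below by 0. *)
Theorem theorem3p4 (R : realType) (S A : finType)
  (S_nonempty : (0 < #|S|)%N) (A_nonempty : (0 < #|A|)%N)
  (M : regularized_mdp R S A)
  (d : measure_display) (Omega : measurableType d) (X : trajectories M Omega)
  (f : R -> R) (pmin omega kappa iota : R)
  (pmin_gt0 : 0 < pmin)
  (f_assumption : generator_assumption f pmin omega kappa iota)
  (ref_assumption : forall s a, pmin < ref M s a)
  (init_min_gt0 : 0 < init_min M)
  (theta : S -> A -> R) :
  mu M f omega theta * (opt_value_init X f - value_param X f theta) <=
  sqnorm2 (gradient (value_param X f) theta).
Proof.
have gen := generator_steep f_assumption.
have [s0 _] := card_gt0P S_nonempty; have [a0 _] := card_gt0P A_nonempty.
have term_ge0 s (nu : A -> R) : is_distr nu ->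
    0 <= \sum_a ref M s a * inv_deriv2 f (nu a / ref M s a).
  move=> nuP; apply: sumr_ge0 => a _; rewrite mulr_ge0 ?(ref_policy M s).1 //.
  exact: inv_deriv2_ge0 pmin_gt0 gen (distr_ratio_lt pmin_gt0 (ref_assumption s) _ nuP).
have softmaxP := softargmax_policy pmin_gt0 gen ref_assumption theta.
apply: (gradient_domination X pmin_gt0 gen ref_assumption).
- exact: (gen_omega_ge1 f_assumption).
- exact: ltW.
- move=> s; apply: ge_inf; last by exists s.
  by exists 0 => _ [t _ <-]; exact: (init_distr M).1.
- apply: lb_le_inf => [|_ [s _ [nu nuP <-]]]; last exact: term_ge0.
  by eexists; exists s0 => //; exists (ref M s0) => //; exact: ref_policy.
- move=> s; apply: ge_inf.
    by exists 0 => _ [t _ [nu nuP <-]]; exact: term_ge0.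
  (* The softargmax policy is itself a competitor in [zeta], and its ratios are positive, so
     [inv_deriv2] is plainly [1 / f''] there. *)
  exists s => //; exists (softargmax f (ref M) theta s); first exact: softmaxP.
  apply: eq_bigr => a _; rewrite /inv_deriv2 gt_eqF //.
  have /andP[] // := ratio_softargmax pmin_gt0 gen (ref_policy M s)
    (ref_assumption s) (theta s) a.
- apply: lb_le_inf => [|_ [sa _ <-]]; last exact: sqr_ge0.
  by exists (weight f (ref M) theta s0 a0 ^+ 2); exists (s0, a0).
- move=> s a; apply: ge_inf; last by exists (s, a).
  by exists 0 => _ [sa _ <-]; exact: sqr_ge0.
Qed.
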